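(* For each integer $k\ge 2$, the problem Plurality-CCP$_k$V-TE is in $\mathrm{P}$.
   Context: An election $(C,V)$ has a finite candidate set $C$ and a finite collection $V$ of votes, each a strict linear order over $C$. Plurality winners are the candidates ranked first by the largest number of votes. For fixed $k\ge2$, Plurality-CCP$_k$V-TE (control by $k$-partition of voters, ties-eliminate) asks the following. Given $C$, $V$, and a distinguished $p\in C$, is there a partition of $V$ into $k$ parts $V_1,\dots,V_k$ such that $p$ is the sole plurality winner of a final election? That final election is held over the set of candidates $c$ such that, for some $i$, $c$ is the unique plurality winner of $(C,V_i)$. Votes are restricted to that set. A subelection with more than one winner sends no candidate forward. *)

(* Defs.v *)
From mathcomp Require Import all_boot.
Set Implicit Arguments. Unset Strict Implicit. Unset Printing Implicit Defensive.

(* Candidates of an election with m candidates are 0, ..., m-1.        *)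
(* A vote is a strict linear order over the candidates, represented as *)
(* the list of candidates from most to least preferred (a permutation  *)
(* of iota 0 m).  A (sub)collection of votes is a seq of votes.        *)

Definition vote := seq nat.

Definition top_in (D : seq nat) (v : vote) : option nat :=
  ohead [seq c <- v | c \in D].

Definition pscore (D : seq nat) (U : seq vote) (c : nat) : nat :=
  count (fun v => top_in D v == Some c) U.

Definition unique_winner (D : seq nat) (U : seq vote) (c : nat) : bool :=
  (c \in D) && all (fun d => (d == c) || (pscore D U d < pscore D U c)) D.

Record instance := Instance { ncand : nat; votes : seq vote; dist : nat }.

Definition valid_instance (I : instance) : bool :=
  (dist I < ncand I) && all (fun v => perm_eq v (iota 0 (ncand I))) (votes I).

(* A partition of V into k parts V_0..V_{k-1} is an assignment of each
   vote (by position) to a part index < k (parts may be empty). *)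
Definition part (V : seq vote) (asg : seq nat) (i : nat) : seq vote :=
  [seq vp.1 | vp <- zip V asg & vp.2 == i].

Definition finalists (m k : nat) (V : seq vote) (asg : seq nat) : seq nat :=
  [seq c <- iota 0 m |
     has (fun i => unique_winner (iota 0 m) (part V asg i) c) (iota 0 k)].

Definition ccpv_te_yes (k : nat) (I : instance) : Prop :=
  exists asg : seq nat,
    [/\ size asg = size (votes I), all (fun a => a < k) asg &
        unique_winner (finalists (ncand I) k (votes I) asg) (votes I) (dist I)].

(* naturals in unary, self-delimited: n |-> 1^n 0.  Since every vote     *)
(* lists all m candidates, unary candidate names only change the input  *)
(* length polynomially w.r.t. a binary encoding.                        *)
Definition enc_nat (n : nat) : seq bool := rcons (nseq n true) false.

Definition enc_vote (v : vote) : seq bool := flatten (map enc_nat v).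

Definition enc_instance (I : instance) : seq bool :=
  enc_nat (ncand I) ++ enc_nat (dist I) ++ enc_nat (size (votes I)) ++
  flatten (map enc_vote (votes I)).

Definition CCPV_TE_lang (k : nat) (w : seq bool) : Prop :=
  exists I : instance,
    [/\ valid_instance I, enc_instance I = w & ccpv_te_yes k I].

Inductive move := MoveL | MoveR | Stay.

(* states 'I_Q.+1 (start state ord0), tape symbols 'I_G.+3 where
   symbol 0 is the blank, 1 encodes bit false, 2 encodes bit true. *)
Record TM := {
  tm_Q : nat;
  tm_G : nat;
  tm_delta : 'I_tm_Q.+1 -> 'I_tm_G.+3 -> 'I_tm_Q.+1 * 'I_tm_G.+3 * move;
  tm_acc : 'I_tm_Q.+1;
  tm_rej : 'I_tm_Q.+1 }.

Section TMsem.
Variable M : TM.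
Definition sym := 'I_(tm_G M).+3.
Definition blank : sym := inord 0.
Definition sym_of_bool (b : bool) : sym := inord (if b then 2 else 1).

(* configuration: state, left part of tape (nearest cell first),
   scanned symbol, right part of tape (nearest cell first) *)
Definition config := ('I_(tm_Q M).+1 * seq sym * sym * seq sym)%type.

Definition halted (c : config) : bool :=
  (c.1.1.1 == tm_acc M) || (c.1.1.1 == tm_rej M).

Definition step (c : config) : config :=
  if halted c then c else
  let: (q, l, a, r) := c in
  let: (q', b, mv) := tm_delta q a in
  match mv with
  | MoveL => (q', behead l, head blank l, b :: r)
  | MoveR => (q', b :: l, head blank r, behead r)
  | Stay  => (q', l, b, r)
  end.

Definition init (w : seq bool) : config :=
  let t := map sym_of_bool w in (ord0, [::], head blank t, behead t).

Definition run (n : nat) (w : seq bool) : config := iter n step (init w).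
End TMsem.

Definition decides_in_poly_time (M : TM) (L : seq bool -> Prop) : Prop :=
  exists c d : nat, forall w : seq bool,
    let cf := run M (c * size w ^ d + c) w in
    halted cf /\ (cf.1.1.1 = tm_acc M <-> L w).

Definition in_P (L : seq bool -> Prop) : Prop :=
  exists M : TM, decides_in_poly_time M L.

(* Main.v *)
Require Import Defs.
From mathcomp Require Import all_boot zify.

Set Implicit Arguments. Unset Strict Implicit. Unset Printing Implicit Defensive.

(** The first round depends only on the multiset of first choices. For [k] fixed, there are
    polynomially many sets [t] of at most [k] candidates, and one asks which are possible sets
    of finalists. A candidate [d] outside [t] must not win any part; if [t'] collects, for each
    part, a candidate other than [d] that is at least as strong there (the winner, if there is
    one), then counting votes gives nv(d) + |t| <= nv(t'), where [t'] has at most [k] elements,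
    contains [t] and omits [d]. Conversely, if every [d] has such a [t'], then a partition is
    obtained from the [t'] of the strongest [d] outside [t]. This criterion is a
    quantification over a bounded number of candidates of conditions expressible by counting,
    so it can be evaluated by bounded loops over registers with values at most the input
    length. Each register is a mark on a tape of that length, and every register instruction
    is a single sweep of a Turing machine over its tape. *)

(** * Turing machines working by sweeps *)

(** Read backwards, the inequality is a count of slots. A winner in [t] leaves room in its own part
    for one vote less than it has itself, any other member of [t'] for as many votes as it has, and
    a candidate with at most nv(d) votes fits into the total. The obstacle is that a part meant to
    elect nobody needs a second candidate to complete the tie, and [d] may have too few votes to do
    this for all the other members of [t']. Surplus ones are therefore dropped, and the last one
    dropped ties with [d] at the number of votes that [d] has left. A single candidate is a separate
    case, since then even an empty part has a unique winner. On the machine side no value can exceed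
    the input length, so all arithmetic saturates; on genuine encodings saturation never affects the
    answer. *)

Section SweepMachine.
Variables (C Q : finType) (inj : bool -> C) (q0 : Q).
Variables (delta : Q -> C -> Q * C) (fin : Q -> Q + bool).

Fixpoint sweep (q : Q) (s : seq C) : Q * seq C :=
  if s is c :: s' then
    let qc := delta q c in let qs := sweep qc.1 s' in (qs.1, qc.2 :: qs.2)
  else (q, [::]).

Definition round (x : (Q + bool) * seq C) : (Q + bool) * seq C :=
  if x.1 is inl q then let qs := sweep q x.2 in (fin qs.1, qs.2) else x.

Lemma size_sweep q s : size (sweep q s).2 = size s.
Proof. by elim: s q => //= c s IH q; rewrite IH. Qed.

(* [inl (inl q)] sweeps right in state [q]; [inl (inr q)] returns to the left
   end, where a new sweep starts in state [q]; [inr b] is the verdict. *)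
Let S : finType := ((Q + Q) + bool)%type.

(** A machine starts in [ord0], so states are shifted by one and [ord0] is read as a second name for
    the start of a sweep in [q0]. *)
Definition enc_state (s : S) : 'I_(#|S|).+1 := lift ord0 (enum_rank s).
Definition dec_state (q : 'I_(#|S|).+1) : S :=
  if unlift ord0 q is Some i then enum_val i else inl (inl q0).
(** Symbol 0 is the blank, and 1 and 2 are raw input bits, read as [inj false] and [inj true].
    Encoded cells start at 3; the first sweep replaces the raw bits by them. *)
Definition enc_cell (c : C) : 'I_(#|C|).+3 :=
  lift ord0 (lift ord0 (lift ord0 (enum_rank c))).
Definition dec_cell (a : 'I_(#|C|).+3) : option C :=
  if unlift ord0 a is Some b then
    Some (if unlift ord0 b is Some b' then
            if unlift ord0 b' is Some i then enum_val i else inj true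
          else inj false)
  else None.

Lemma enc_stateK s : dec_state (enc_state s) = s.
Proof. by rewrite /dec_state /enc_state liftK enum_rankK. Qed.

Lemma enc_cellK c : dec_cell (enc_cell c) = Some c.
Proof. by rewrite /dec_cell /enc_cell !liftK enum_rankK. Qed.

Definition sweep_delta (q : 'I_(#|S|).+1) (a : 'I_(#|C|).+3) :
    'I_(#|S|).+1 * 'I_(#|C|).+3 * move :=
  match dec_state q with
  | inl (inl p) =>
    if dec_cell a is Some c then
      let qc := delta p c in (enc_state (inl (inl qc.1)), enc_cell qc.2, MoveR)
    else match fin p with
         | inl p' => (enc_state (inl (inr p')), ord0, MoveL)
         | inr b => (enc_state (inr b), ord0, Stay)
         end
  | inl (inr p) =>
    if dec_cell a is Some c then (q, a, MoveL)
    else (enc_state (inl (inl p)), ord0, MoveR)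
  | inr b => (q, a, Stay)
  end.

Definition sweep_TM : TM :=
  {| tm_delta := sweep_delta; tm_acc := enc_state (inr true);
     tm_rej := enc_state (inr false) |}.

Local Notation M := sweep_TM.
Local Notation blk := (blank M).

Lemma blankE : blk = ord0.
Proof. by apply/val_inj; rewrite /= inordK. Qed.

Lemma dec_blank : dec_cell blk = None.
Proof. by rewrite blankE /dec_cell; case: unliftP => // j /(congr1 val). Qed.

Lemma dec_sym_of_bool b : dec_cell (sym_of_bool M b) = Some (inj b).
Proof.
have -> : sym_of_bool M b = lift ord0 (if b then lift ord0 ord0 else ord0).
  by apply/val_inj; rewrite /= inordK; case: b.
rewrite /dec_cell liftK; case: b; last by rewrite unlift_none.
by rewrite liftK unlift_none.
Qed.

(* Configurations scanning the first cell of [T], resp. the last cell of [rev l]. *)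
Definition at_head (q : 'I_(#|S|).+1) (l T : seq (sym M)) : config M :=
  (q, l, head blk T, behead T).
Definition at_last (q : 'I_(#|S|).+1) (l T : seq (sym M)) : config M :=
  (q, behead l, head blk l, T).

Lemma not_halted q l a r p :
  dec_state q = inl p -> halted ((q, l, a, r) : config M) = false.
Proof.
move=> e; rewrite /halted /=.
have ne b : (q == enc_state (inr b)) = false.
  by apply/eqP => h; move: e; rewrite h enc_stateK.
by rewrite !ne.
Qed.

(** State and cells are known only up to decoding: the first sweep meets raw bits, and on an empty
    tape the machine may still be in [ord0] at the right end. *)
Lemma run_sweep s q T l z p :
    map dec_cell T = map Some s -> dec_state q = inl (inl p) ->
  exists q', dec_state q' = inl (inl (sweep p s).1) /\
    iter (size s) (@step M) (at_head q l (T ++ z)) =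
    at_head q' (rev (map enc_cell (sweep p s).2) ++ l) z.
Proof.
elim: s T q l p => [|c s IH] [|a T] //= q l p; first by exists q.
move=> [ea eT] eq; rewrite -iterS iterSr.
rewrite [X in iter _ _ X](_ : _ =
    at_head (enc_state (inl (inl (delta p c).1))) (enc_cell (delta p c).2 :: l) (T ++ z)); last
  by rewrite /step (not_halted _ _ _ eq) /= /sweep_delta eq ea.
have [q' [eq' ->]] := IH T (enc_state (inl (inl (delta p c).1)))
  (enc_cell (delta p c).2 :: l) (delta p c).1 eT (enc_stateK _).
by exists q'; rewrite rev_cons cat_rcons.
Qed.

Lemma run_return s T l p :
  iter (size s) (@step M) (at_last (enc_state (inl (inr p))) (map enc_cell s ++ l) T) =
  at_last (enc_state (inl (inr p))) l (rev (map enc_cell s) ++ T).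
Proof.
elim: s T => [|c s IH] T //; rewrite [size _]/= iterSr.
have -> : step (at_last (enc_state (inl (inr p))) (map enc_cell (c :: s) ++ l) T) =
    at_last (enc_state (inl (inr p))) (map enc_cell s ++ l) (enc_cell c :: T).
  by rewrite /step (not_halted _ _ _ (enc_stateK _)) /= /sweep_delta enc_stateK enc_cellK.
by rewrite IH /= rev_cons cat_rcons.
Qed.

(** Only the first cell on either side has to be blank: the head turns there, and each turn leaves
    an explicit blank in the list. *)
Definition represents (cf : config M) (x : (Q + bool) * seq C) : Prop :=
  match x.1 with
  | inl p => exists q T l z, [/\ cf = at_head q l (T ++ z), dec_state q = inl (inl p),
      map dec_cell T = map Some x.2, head blk l = blk & head blk z = blk]
  | inr b => cf.1.1.1 = enc_state (inr b)
  end.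

Lemma represents_halted cf b s :
  represents cf (inr b, s) -> halted cf /\ (cf.1.1.1 = tm_acc M <-> b).
Proof.
rewrite /represents /halted /= => ->; case: b; rewrite ?eqxx ?orbT; split=> //.
by split=> // /lift_inj /enum_rank_inj.
Qed.

Lemma step_halted cf : halted cf -> @step M cf = cf.
Proof. by rewrite /step => ->. Qed.

Lemma represents_round cf x :
  represents cf x -> exists t, t <= 2 * size x.2 + 2 /\ represents (iter t (@step M) cf) (round x).
Proof.
case: x => [[p|b] s]; last by exists 0.
move=> [q [T [l [z [-> eq eT el ez]]]]].
have [q' [eq' e1]] := run_sweep l z eT eq.
rewrite /round /=; move: e1 eq'; case E: (sweep p s) => [p' s'] /= e1 eq'.
have ss' : size s' = size s by rewrite -(size_sweep p s) E.
have := not_halted (rev (map enc_cell s') ++ l) (head blk z) (behead z) eq'.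
case Ef: (fin p') => [p''|b] hn; last first.
  exists (size s).+1; split; first by lia.
  by rewrite iterS e1 /step hn /= ez /sweep_delta eq' dec_blank Ef.
(* Read from the right: the sweep, the turn at the right blank, the return, the turn at the left
   blank. *)
exists (1 + (size s + (1 + size s))); split; first by lia.
rewrite !iterD e1 /=.
have -> : step (at_head q' (rev (map enc_cell s') ++ l) z) =
   at_last (enc_state (inl (inr p''))) (rev (map enc_cell s') ++ l) (blk :: behead z).
  by rewrite /step hn /= ez /sweep_delta eq' dec_blank Ef /at_last blankE.
rewrite -map_rev -ss' -size_rev run_return map_rev revK.
rewrite /step (not_halted _ _ _ (enc_stateK _)) /= el /sweep_delta enc_stateK dec_blank.
exists (enc_state (inl (inl p''))), (map enc_cell s'), (blk :: behead l), (blk :: behead z).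
split=> //; rewrite ?enc_stateK //; last first.
  by rewrite -map_comp; apply: eq_map => c /=; rewrite enc_cellK.
by rewrite /at_head blankE.
Qed.
End SweepMachine.

Lemma in_P_sweep (C Q : finType) (inj : bool -> C) (q0 : Q)
    (delta : Q -> C -> Q * C) (fin : Q -> Q + bool) (L : seq bool -> Prop) c d :
  (forall w, exists t b s, [/\ t <= c * size w ^ d + c,
     iter t (round delta fin) (inl q0, map inj w) = (inr b, s) & b <-> L w]) ->
  in_P L.
Proof.
move=> H; exists (sweep_TM inj q0 delta fin), (6 * c), d.+1 => w.
have [t [b [s [let_ et bL]]]] := H w.
have rep0 : represents (init (sweep_TM inj q0 delta fin) w) (inl q0, map inj w).
  exists ord0, (map (sym_of_bool (sweep_TM inj q0 delta fin)) w), [::], [::].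
  split=> //; first by rewrite cats0.
  - by rewrite /dec_state unlift_none.
  - by rewrite -!map_comp; apply: eq_map => a /=; rewrite dec_sym_of_bool.
have [N [leN]] : exists N, N <= t * (2 * size w + 2) /\
    represents (iter N (@step _) (init (sweep_TM inj q0 delta fin) w))
      (iter t (round delta fin) (inl q0, map inj w)).
  elim: t {let_ et} => [|t [N [leN IH]]]; first by exists 0.
  have [N' [leN' IH']] := represents_round IH.
  exists (N' + N); split; last by rewrite iterD iterS.
  have e : size (iter t (round delta fin) (inl q0, map inj w)).2 = size w.
    rewrite -(size_map inj w); elim: (t) => //= t' <-; rewrite /round.
    by case: (iter t' _ _).1 => //= q; rewrite size_sweep.
  move: leN'; rewrite e; lia.
rewrite et => rep; have [hlt acc] := represents_halted rep.
have leN2 : N <= 6 * c * size w ^ d.+1 + 6 * c.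
  apply: (leq_trans leN); apply: leq_trans (leq_mul let_ (leqnn _)) _.
  (* For n > 0, (c n^d + c)(2n + 2) is at most 6c n^(d+1) + 6c because lower powers of n are bounded
     by higher ones; this fails at n = 0, where [0 ^ 0] is 1. *)
  case: (size w) => [|n]; first by case: (d) => [|d']; rewrite ?expn0 ?exp0n //; lia.
  have h1 : n.+1 <= n.+1 ^ d.+1 by rewrite -[X in X <= _]expn1 leq_pexp2l.
  have h2 : n.+1 ^ d <= n.+1 ^ d.+1 by rewrite leq_pexp2l.
  by move: h1 h2; rewrite expnS; set x := _ ^ d; set y := _ * x; nia.
rewrite /run -(subnK leN2) iterD; set cf := iter N _ _ in hlt acc *.
have -> : iter (6 * c * size w ^ d.+1 + 6 * c - N) (@step _) cf = cf.
  by elim: (_ - N) => //= t' ->; rewrite step_halted.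
by split=> //; rewrite acc bL.
Qed.

(** * Register programs *)

Inductive instr :=
  | Izero of nat | Icopy of nat & nat | Iinc of nat
  | Ibit of nat & nat | Ieq of nat & nat & nat.

Definition upd (R : nat -> nat) (r v : nat) : nat -> nat :=
  fun s => if s == r then v else R s.

Definition ireg (i : instr) : nat :=
  match i with
  | Izero r | Iinc r | Ibit r _ => r
  | Icopy r s | Ieq r s _ => maxn r s
  end.

(* Registers hold values at most [size w]; [Ibit] and [Ieq] are conditional jumps. *)
Definition iexec (w : seq bool) (i : instr) (x : nat * (nat -> nat)) :
    nat * (nat -> nat) :=
  let: (pc, R) := x in
  match i with
  | Izero r => (pc.+1, upd R r 0)
  | Icopy r s => (pc.+1, upd R r (R s))
  | Iinc r => (pc.+1, upd R r (minn (size w) (R r).+1))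
  | Ibit r l => (if nth false w (R r) then l else pc.+1, R)
  | Ieq r s l => (if R r == R s then l else pc.+1, R)
  end.

Definition pstep (P : seq instr) (w : seq bool) (x : nat * (nat -> nat)) :=
  if x.1 < size P then iexec w (nth (Izero 0) P x.1) x else x.

Section Program.
Variable P : seq instr.
Let h := \max_(j < size P) ireg (nth (Izero 0) P j).
Let C : finType := (bool * {ffun 'I_h.+1 -> bool})%type.
Let Q : finType := ('I_(size P).-1.+1 * bool)%type.

(* Register [r] with value [v] is a mark in track [r] of cell [v]; there is no mark
   when [v] is the length of the tape. *)
Definition mark (c : C) (r : nat) : bool := c.2 (inord r).
Definition set_mark (c : C) (r : nat) (b : bool) : C :=
  (c.1, [ffun s => if s == inord r then b else c.2 s]).

Definition tape (w : seq bool) (R : nat -> nat) : seq C :=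
  [seq (nth false w j, [ffun s : 'I_h.+1 => R s == j]) | j <- iota 0 (size w)].

Definition start_bit (i : instr) : bool :=
  match i with Izero _ | Ieq _ _ _ => true | _ => false end.

(** The bit carried along a sweep says, for [Izero], that the cell is the first one; for [Iinc],
    that the previous cell had the mark; for [Ibit], that the mark was seen on a [true]; for [Ieq],
    that the two tracks agree so far. *)
Definition cell_step (i : instr) (b : bool) (c : C) : bool * C :=
  match i with
  | Izero r => (false, set_mark c r b)
  | Icopy r s => (false, set_mark c r (mark c s))
  | Iinc r => (mark c r, set_mark c r b)
  | Ibit r l => (b || (mark c r && c.1), c)
  | Ieq r s l => (b && (mark c r == mark c s), c)
  end.

Definition prog_start (pc : nat) : Q :=
  (inord pc, start_bit (nth (Izero 0) P pc)).

Definition prog_delta (q : Q) (c : C) : Q * C :=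
  let bc := cell_step (nth (Izero 0) P q.1) q.2 c in ((q.1, bc.1), bc.2).

(** Leaving the program at address [size P] exactly accepts; leaving it further out rejects. *)
Definition prog_fin (q : Q) : Q + bool :=
  let pc' := match nth (Izero 0) P q.1 with
             | Ibit _ l | Ieq _ _ l => if q.2 then l else q.1.+1
             | _ => q.1.+1
             end in
  if pc' < size P then inl (prog_start pc') else inr (pc' == size P).

(** With [f j] a closed form of the bit carried into cell [j], a whole sweep is checked cell by
    cell. *)
Lemma sweep_map (f : nat -> bool) (g g' : nat -> C) i a b (q : 'I_(size P).-1.+1) :
  (forall j, j < a + b -> cell_step i (f j) (g j) = (f j.+1, g' j)) ->
  nth (Izero 0) P q = i ->
  sweep prog_delta (q, f a) (map g (iota a b)) = ((q, f (a + b)), map g' (iota a b)).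
Proof.
move=> H e; elim: b a H => [|b IH] a H /=; first by rewrite addn0.
rewrite {1 2}/prog_delta /= e H /=; last by lia.
by rewrite addnS -addSn IH // => j lj; apply: H; lia.
Qed.

Lemma mark_tape w (R : nat -> nat) r j : r <= h ->
  mark (nth false w j, [ffun s : 'I_h.+1 => R s == j]) r = (R r == j).
Proof. by move=> le; rewrite /mark ffunE inordK. Qed.

Lemma set_mark_tape w (R : nat -> nat) r j v : r <= h ->
  set_mark (nth false w j, [ffun s : 'I_h.+1 => R s == j]) r (v == j) =
  (nth false w j, [ffun s : 'I_h.+1 => upd R r v s == j]).
Proof.
move=> le; congr pair; apply/ffunP => s; rewrite !ffunE /upd -val_eqE /= inordK //.
by case: ifP.
Qed.

Lemma sweep_instr w (R : nat -> nat) (pc : nat) :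
    pc < size P -> (forall r, R r <= size w) ->
  exists b, let i := nth (Izero 0) P pc in
    sweep prog_delta (prog_start pc) (tape w R) =
      ((inord pc, b), tape w (iexec w i (pc, R)).2) /\
    (iexec w i (pc, R)).1 =
      match i with Ibit _ l | Ieq _ _ l => if b then l else pc.+1 | _ => pc.+1 end.
Proof.
move=> lpc leR /=; rewrite /prog_start.
have eP : nth (Izero 0) P (inord pc : 'I_(size P).-1.+1) = nth (Izero 0) P pc.
  by rewrite inordK //; lia.
have leh : ireg (nth (Izero 0) P pc) <= h.
  exact: (leq_bigmax (Ordinal lpc)).
have main f i : i = nth (Izero 0) P pc -> f 0 = start_bit i ->
    (forall j, j < size w -> cell_step i (f j)
      (nth false w j, [ffun s : 'I_h.+1 => R s == j]) =
      (f j.+1, (nth false w j, [ffun s : 'I_h.+1 => (iexec w i (pc, R)).2 s == j]))) ->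
    sweep prog_delta (inord pc, start_bit i) (tape w R) =
      ((inord pc, f (size w)), tape w (iexec w i (pc, R)).2).
  by move=> ei <- H; rewrite (@sweep_map f _ _ i 0 (size w) (inord pc) H) ?eP.
case E: (nth (Izero 0) P pc) leh => [r|r s|r|r l|r s l] /=.
- move=> leh; exists (size w == 0); split=> //.
  rewrite -/(start_bit (Izero r)) (main (fun j => j == 0) _ (esym E) erefl) // => j _.
  by rewrite [j == 0]eq_sym /= set_mark_tape.
- rewrite geq_max => /andP[lr ls]; exists false; split=> //.
  rewrite -/(start_bit (Icopy r s)) (main (fun j => false) _ (esym E) erefl) // => j _.
  by rewrite /= mark_tape // set_mark_tape.
- move=> leh; exists (if size w is j.+1 then R r == j else false); split=> //.
  rewrite -/(start_bit (Iinc r)).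
  (* A mark pushed out of the last cell disappears, which is the value [size w]; hence the
     saturation in [Iinc]. *)
  rewrite (main (fun j => if j is j'.+1 then R r == j' else false) _ (esym E) erefl) // => j lj.
  rewrite /= mark_tape //; congr pair; rewrite -set_mark_tape //; congr set_mark.
  by case: j lj => [|j] lj; apply/esym/eqP; [lia|case: eqP; lia].
- move=> leh; exists (nth false w (R r)); split=> //.
  rewrite -/(start_bit (Ibit r l)).
  rewrite (main (fun j => (R r < j) && nth false w (R r)) _ (esym E)) => [||j lj].
  + have := leR r; rewrite leq_eqVlt => /orP[/eqP->|->] //=.
    by rewrite ltnn nth_default.
  + by rewrite ltn0.
  rewrite /= mark_tape //; congr pair; rewrite [R r < j.+1]ltnS.
  by case: (ltngtP (R r) j) => [||->] //=; rewrite ?orbF.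
- rewrite geq_max => /andP[lr ls]; exists (R r == R s); split=> //.
  rewrite -/(start_bit (Ieq r s l)).
  (* The tracks agree before cell [j] iff the values are equal or neither mark has been passed. At
     the right end the second case forces both values to be [size w]. *)
  rewrite (main (fun j => (R r == R s) || (j <= R r) && (j <= R s)) _ (esym E)) => [||j lj].
  + do 2 congr pair; case: eqP => //= ne; have := leR r; have := leR s; lia.
  + by rewrite orbT.
  rewrite /= !mark_tape //; congr pair.
  by case: (R r =P R s); case: (R r =P j); case: (R s =P j) => /=; lia.
Qed.

Lemma pstep_le w x : (forall r, x.2 r <= size w) -> forall r, (pstep P w x).2 r <= size w.
Proof.
case: x => pc R /= leR; rewrite /pstep /=; case: ifP => // _ r.
by case: nth => [s|s s'|s|s l|s s' l] //=; rewrite /upd; case: eqP => // _; lia.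
Qed.

Lemma prog_round w pc (R : nat -> nat) t :
    (forall r, R r <= size w) -> pc < size P ->
    size P <= (iter t (pstep P w) (pc, R)).1 ->
  exists t' s, t' <= t /\ iter t' (round prog_delta prog_fin)
    (inl (prog_start pc), tape w R) = (inr ((iter t (pstep P w) (pc, R)).1 == size P), s).
Proof.
elim: t pc R => [|t IH] pc R leR lpc /=; first by rewrite leqNgt lpc.
rewrite -iterS iterSr; have leR' := @pstep_le w (pc, R) leR.
have [b [e1 e2]] := sweep_instr lpc leR.
have er : round prog_delta prog_fin (inl (prog_start pc), tape w R) =
    (let pc' := (pstep P w (pc, R)).1 in
     if pc' < size P then inl (prog_start pc') else inr (pc' == size P),
     tape w (pstep P w (pc, R)).2).
  rewrite /round /= e1 /pstep /= lpc /prog_fin /= inordK; last by lia.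
  by rewrite e2; case: nth.
move: er leR'; case: (pstep P w (pc, R)) => pc' R' /= er leR'.
case: (ltnP pc' (size P)) er => lpc' er hyp.
  have [t' [s [lt' et']]] := IH pc' R' leR' lpc' hyp.
  by exists t'.+1, s; rewrite iterSr er.
exists 1, (tape w R') => /=; rewrite er; split=> //.
suff -> : iter t (pstep P w) (pc', R') = (pc', R') by [].
by elim: (t) => //= t'' ->; rewrite /pstep /= ltnNge lpc'.
Qed.
End Program.

(** Registers start at [size w] because the input tape bears no marks. *)
Lemma in_P_program (P : seq instr) (L : seq bool -> Prop) c d :
    0 < size P ->
  (forall w, exists t, [/\ t <= c * size w ^ d + c,
      size P <= (iter t (pstep P w) (0, fun=> size w)).1 &
      (iter t (pstep P w) (0, fun=> size w)).1 = size P <-> L w]) ->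
  in_P L.
Proof.
move=> P0 H.
apply: (in_P_sweep (inj := fun b => (b, [ffun=> false]))
  (q0 := prog_start P 0) (delta := @prog_delta P) (fin := @prog_fin P) (c := c) (d := d)) => w.
have [t [lt_ ht hL]] := H w.
have [t' [s [lt' et]]] := prog_round (w := w) (R := fun=> size w) (fun=> leqnn _) P0 ht.
exists t', ((iter t (pstep P w) (0, fun=> size w)).1 == size P), s; split.
- exact: leq_trans lt' lt_.
- rewrite -et; congr (iter _ _ (_, _)); apply: (@eq_from_nth _ (true, [ffun=> false])).
    by rewrite !size_map size_iota.
  move=> j; rewrite size_map => lj.
  rewrite (nth_map false) // (nth_map 0) ?size_iota // nth_iota //.
  by congr pair; apply/ffunP => s'; rewrite !ffunE; apply/esym/negbTE; rewrite neq_ltn lj orbT.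
- by rewrite -hL; split=> /eqP.
Qed.

(** * Loop programs *)

Inductive expr :=
  | Var of nat | Full | Zero | Succ of expr | BitAt of expr | Let of expr & expr
  | Loop of expr & expr & expr | Weak of (nat -> nat) & expr.

Definition scons {T} (x : T) (s : nat -> T) (i : nat) : T :=
  if i is j.+1 then s j else x.

(* Variables are de Bruijn indices; [Loop e1 e2 e3] starts from the value of [e2] and
   iterates [e3], with the accumulator as variable 0 and the round number as 1. *)
Fixpoint eval (w : seq bool) (e : expr) (rho : nat -> nat) : nat :=
  match e with
  | Var i => rho i
  | Full => size w
  | Zero => 0
  | Succ e1 => minn (size w) (eval w e1 rho).+1
  | BitAt e1 => minn (size w) (nth false w (eval w e1 rho))
  | Let e1 e2 => eval w e2 (scons (eval w e1 rho) rho)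
  | Loop e1 e2 e3 =>
    iteri (eval w e1 rho) (fun i acc => eval w e3 (scons acc (scons i rho)))
      (eval w e2 rho)
  | Weak f e1 => eval w e1 (fun i => rho (f i))
  end.

(* The code of [e] placed at address [a] when variable [i] is stored in register
   [m i < d] and register 0 holds the length of the input; it leaves the value in
   register [d] and the lower registers unchanged. *)
Fixpoint compile (e : expr) (m : nat -> nat) (d a : nat) : seq instr :=
  match e with
  | Var i => [:: Icopy d (m i)]
  | Full => [:: Icopy d 0]
  | Zero => [:: Izero d]
  | Succ e1 => rcons (compile e1 m d a) (Iinc d)
  | BitAt e1 =>
    let c1 := compile e1 m d a in let b := a + size c1 in
    c1 ++ [:: Ibit d b.+3; Izero d; Ieq d d (b + 5); Izero d; Iinc d]
  | Let e1 e2 =>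
    let c1 := compile e1 m d a in
    let c2 := compile e2 (scons d m) d.+1 (a + size c1) in
    c1 ++ rcons c2 (Icopy d d.+1)
  | Loop e1 e2 e3 =>
    let c2 := compile e2 m d a in
    let c1 := compile e1 m d.+1 (a + size c2) in
    let b := (a + size c2 + size c1).+1 in
    let c3 := compile e3 (scons d (scons d.+2 m)) d.+3 b.+1 in
    c2 ++ c1 ++ [:: Izero d.+2; Ieq d.+2 d.+1 (b + size c3 + 4)] ++ c3 ++
    [:: Icopy d d.+3; Iinc d.+2; Ieq d d b]
  | Weak f e1 => compile e1 (fun i => m (f i)) d a
  end.

Fixpoint cost (e : expr) (n : nat) : nat :=
  match e with
  | Var _ | Full | Zero => 1
  | Succ e1 => (cost e1 n).+1
  | BitAt e1 => cost e1 n + 3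
  | Let e1 e2 => cost e1 n + cost e2 n + 1
  | Loop e1 e2 e3 => cost e1 n + cost e2 n + 2 + n * (cost e3 n + 4)
  | Weak _ e1 => cost e1 n
  end.

(** Values are at most the input length, so a loop multiplies the cost of its body by at most [n].
    The base [n.+1] is positive, so exponents can be raised freely. *)
Lemma cost_poly e : exists c d, forall n, cost e n <= c * n.+1 ^ d.
Proof.
have mono c d d' n : d <= d' -> c * n.+1 ^ d <= c * n.+1 ^ d'.
  by move=> le; rewrite leq_mul2l leq_pexp2l ?orbT.
have pos d n : 0 < n.+1 ^ d by rewrite expn_gt0.
elim: e => [i|||e1 [c1 [d1 H1]]|e1 [c1 [d1 H1]]|e1 [c1 [d1 H1]] e2 [c2 [d2 H2]]
  |e1 [c1 [d1 H1]] e2 [c2 [d2 H2]] e3 [c3 [d3 H3]]|f e1 [c1 [d1 H1]]] /=.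
- by exists 1, 0.
- by exists 1, 0.
- by exists 1, 0.
- exists c1.+1, d1 => n; have := H1 n; have := pos d1 n; lia.
- exists (c1 + 3), d1 => n; have := H1 n; have := pos d1 n; lia.
- exists (c1 + c2 + 1), (d1 + d2) => n; have := pos (d1 + d2) n.
  have := leq_trans (H1 n) (mono c1 d1 (d1 + d2) n (leq_addr _ _)).
  have := leq_trans (H2 n) (mono c2 d2 (d1 + d2) n (leq_addl _ _)); lia.
- exists (c1 + c2 + c3 + 6), (d1 + d2 + d3).+1 => n.
  have h1 := leq_trans (H1 n) (mono c1 d1 (d1 + d2 + d3) n ltac:(lia)).
  have h2 := leq_trans (H2 n) (mono c2 d2 (d1 + d2 + d3) n ltac:(lia)).
  have h3 := leq_trans (H3 n) (mono c3 d3 (d1 + d2 + d3) n ltac:(lia)).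
  have := pos (d1 + d2 + d3) n; rewrite expnS.
  move: h1 h2 h3; set x := n.+1 ^ _; move: (cost e1 n) (cost e2 n) (cost e3 n) x.
  move=> x1 x2 x3 x h1 h2 h3 p.
  have h4 : n * (x3 + 4) <= n * (c3 * x + 4 * x) by rewrite leq_mul2l; lia.
  nia.
- by exists c1, d1.
Qed.

Lemma eval_le w e rho : (forall i, rho i <= size w) -> eval w e rho <= size w.
Proof.
elim: e rho => [i|||e1 H1|e1 H1|e1 H1 e2 H2|e1 H1 e2 H2 e3 H3|f e1 H1] rho le //=.
- exact: geq_minl.
- exact: geq_minl.
- by apply: H2 => -[|i] //=; exact: H1.
- have l1 := H1 rho le; move: (eval w e1 rho) l1 => l; elim: l => [|l IH] ll /=.
    exact: H2.
  by apply: H3 => -[|[|i]] /=; [exact: IH (ltnW ll)|exact: ltnW|].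
- by apply: H1.
Qed.

Definition code_at (P : seq instr) (a : nat) (c : seq instr) : Prop :=
  a + size c <= size P /\ forall i, i < size c -> nth (Izero 0) P (a + i) = nth (Izero 0) c i.

Lemma code_at_cat P a c1 c2 :
  code_at P a (c1 ++ c2) -> code_at P a c1 /\ code_at P (a + size c1) c2.
Proof.
rewrite /code_at size_cat => -[le H]; split; split; [lia| |lia|] => i li.
- by rewrite H ?nth_cat ?li //; lia.
- by rewrite -addnA H ?nth_cat; [rewrite ltnNge leq_addr addKn|lia].
Qed.

Lemma pstep_at P w a i c R : code_at P a (i :: c) -> pstep P w (a, R) = iexec w i (a, R).
Proof.
move=> [/= le H]; rewrite /pstep /= -[X in nth _ _ X]addn0 H //.
by rewrite ifT //; lia.
Qed.

Lemma code_at_cons P a i c : code_at P a (i :: c) -> code_at P a.+1 c.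
Proof. by rewrite -cat1s => /code_at_cat[_]; rewrite /= addn1. Qed.

Definition reaches P w t x y := exists2 t', t' <= t & iter t' (pstep P w) x = y.

Lemma reaches_trans P w t1 t2 x y z :
  reaches P w t1 x y -> reaches P w t2 y z -> reaches P w (t1 + t2) x z.
Proof.
move=> [s1 l1 <-] [s2 l2 <-]; exists (s2 + s1); first lia.
by rewrite iterD.
Qed.

Lemma reaches_step P w a i c R x :
  code_at P a (i :: c) -> x = iexec w i (a, R) -> reaches P w 1 (a, R) x.
Proof. by move=> H ->; exists 1 => //=; rewrite (pstep_at _ _ H). Qed.

Lemma upd_eq R r v : upd R r v r = v.
Proof. by rewrite /upd eqxx. Qed.

Lemma upd_neq R r v s : s != r -> upd R r v s = R s.
Proof. by rewrite /upd => /negbTE->. Qed.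

(** A loop keeps its accumulator in [d], its bound in [d.+1], its counter in [d.+2], and evaluates
    its body into [d.+3]. [Ieq d d] serves as an unconditional jump. *)
Lemma compileP P w e m d a R rho :
    code_at P a (compile e m d a) -> (forall i, m i < d) ->
    (forall i, R (m i) = rho i) -> R 0 = size w -> (forall r, R r <= size w) ->
  exists R', [/\ reaches P w (cost e (size w)) (a, R) (a + size (compile e m d a), R'),
    R' d = eval w e rho, forall r, r < d -> R' r = R r & forall r, R' r <= size w].
Proof.
elim: e m d a R rho =>
  [i|||e1 H1|e1 H1|e1 H1 e2 H2|e1 H1 e2 H2 e3 H3|f e1 H1] m d a R rho /= at_ lm eR R0 leR.
- exists (upd R d (R (m i))); split.
  + by apply: reaches_step at_ _; rewrite addn1.
  + by rewrite upd_eq.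
  + by move=> r lr; rewrite upd_neq //; lia.
  + by move=> r; rewrite /upd; case: ifP.
- exists (upd R d (R 0)); split.
  + by apply: reaches_step at_ _; rewrite addn1.
  + by rewrite upd_eq.
  + by move=> r lr; rewrite upd_neq //; lia.
  + by move=> r; rewrite /upd; case: ifP.
- exists (upd R d 0); split.
  + by apply: reaches_step at_ _; rewrite addn1.
  + by rewrite upd_eq.
  + by move=> r lr; rewrite upd_neq //; lia.
  + by move=> r; rewrite /upd; case: ifP.
- move: at_; rewrite -cats1 => /code_at_cat[at1 at2].
  have [R1 [r1 v1 k1 l1]] := H1 _ _ _ _ _ at1 lm eR R0 leR.
  exists (upd R1 d (minn (size w) (R1 d).+1)); split.
  + rewrite -addn1; apply: reaches_trans r1 _.
    by apply: reaches_step at2 _; rewrite size_cat addnA addn1.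
  + by rewrite upd_eq v1.
  + by move=> r lr; rewrite upd_neq ?k1 //; lia.
  + by move=> r; rewrite /upd; case: ifP => // _; exact: geq_minl.
- move: at_ => /code_at_cat[at1 at2].
  have [R1 [r1 v1 k1 l1]] := H1 _ _ _ _ _ at1 lm eR R0 leR.
  set b := a + _ in r1 at2 *.
  have at3 := code_at_cons at2; have at4 := code_at_cons at3.
  have at5 := code_at_cons at4; have at6 := code_at_cons at5.
  rewrite size_cat addnA -/b -v1; have [nz|z] := boolP (nth false w (R1 d)).
    exists (upd (upd R1 d 0) d (minn (size w) (upd R1 d 0 d).+1)); split.
    + apply: reaches_trans r1 _; exists 3 => //=.
      rewrite (pstep_at _ _ at2) /= nz (pstep_at _ _ at5) /= (pstep_at _ _ at6) /=.
      by congr pair; lia.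
    + by rewrite !upd_eq.
    + by move=> r lr; rewrite !upd_neq ?k1 //; lia.
    + by move=> r; rewrite {1}/upd upd_eq; case: eqP => _; rewrite ?geq_minl // /upd; case: ifP.
  exists (upd R1 d 0); split.
  + apply: reaches_trans r1 _; exists 3 => //=.
    by rewrite (pstep_at _ _ at2) /= (negbTE z) (pstep_at _ _ at3) /= (pstep_at _ _ at4) /= eqxx.
  + by rewrite upd_eq minn0.
  + by move=> r lr; rewrite upd_neq ?k1 //; lia.
  + by move=> r; rewrite /upd; case: ifP.
- move: at_ => /code_at_cat[at1]; rewrite -cats1 => /code_at_cat[at2 at3].
  have [R1 [r1 v1 k1 l1]] := H1 _ _ _ _ _ at1 lm eR R0 leR.
  have lm2 i : scons d m i < d.+1 by case: i => //= i; exact: ltnW (lm i).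
  have eR2 i : R1 (scons d m i) = scons (eval w e1 rho) rho i.
    by case: i => //= i; rewrite k1.
  have R10 : R1 0 = size w by rewrite k1 //; have := lm 0; lia.
  have [R2 [r2 v2 k2 l2]] := H2 _ _ _ _ _ at2 lm2 eR2 R10 l1.
  exists (upd R2 d (R2 d.+1)); split.
  + apply: reaches_trans (reaches_trans r1 r2) _.
    by apply: reaches_step at3 _; rewrite !size_cat /= !addnA addn1.
  + by rewrite upd_eq.
  + by move=> r lr; rewrite upd_neq ?k2 ?k1 //; lia.
  + by move=> r; rewrite /upd; case: ifP.
- move: at_; set c2 := compile e2 _ _ _; set c1 := compile e1 _ _ _.
  set b := (a + size c2 + size c1).+1; set c3 := compile e3 _ _ _.
  move=> /code_at_cat[at2 /code_at_cat[at1 atb]].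
  have at0 := atb; move: (code_at_cons atb) => atE; have : code_at P (a + size c2 + size c1)
    ([:: Izero d.+2; Ieq d.+2 d.+1 (b + size c3 + 4)] ++ (c3 ++
     [:: Icopy d d.+3; Iinc d.+2; Ieq d d b])) := atb.
  move=> /code_at_cat[_ /code_at_cat[]]; rewrite /= addn2 -/b => at3 atC.
  have atD := code_at_cons atC; have atF := code_at_cons atD.
  have [R2 [r2 v2 k2 l2]] := H2 _ _ _ _ _ at2 lm eR R0 leR.
  have eR2 i : R2 (m i) = rho i by rewrite k2.
  have R20 : R2 0 = size w by rewrite k2 //; have := lm 0; lia.
  have [R1 [r1 v1 k1 l1]] := H1 _ _ _ _ _ at1 (fun i => ltnW (lm i)) eR2 R20 l2.
  pose F := fun i acc => eval w e3 (scons acc (scons i rho)).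
  set n1 := eval w e1 rho in v1 *; set s2 := eval w e2 rho in v2 *; rewrite -/F.
  have ln1 : n1 <= size w by rewrite -v1.
  (* Invariant on reaching the test at [b] after [k] rounds. The 4 extra steps of a round are the
     test, the copy, the increment and the jump back. *)
  suff loop k : k <= n1 -> exists R', [/\
      reaches P w (k * (cost e3 (size w) + 4)) (b, upd R1 d.+2 0) (b, R'),
      [/\ R' d = iteri k F s2, R' d.+1 = n1 & R' d.+2 = k],
      forall r, r < d -> R' r = R r & forall r, R' r <= size w].
    have [R' [r' [v' w' x'] k' l']] := loop n1 (leqnn _).
    exists R'; split=> //.
    have r3 : reaches P w 1 (a + size c2 + size c1, R1) (b, upd R1 d.+2 0).
      exact: reaches_step at0 _.
    have r4 : reaches P w 1 (b, R') (b + size c3 + 4, R').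
      by apply: reaches_step atE _; rewrite /= x' w' eqxx.
    have [t' lt' et'] :=
      reaches_trans r2 (reaches_trans r1 (reaches_trans r3 (reaches_trans r' r4))).
    have le_cost : n1 * (cost e3 (size w) + 4) <= size w * (cost e3 (size w) + 4).
      by rewrite leq_mul2r ln1 orbT.
    exists t'; first by lia.
    rewrite et' -/c3 !size_cat /= size_cat /=; congr pair.
    by move: (size c3) => s3; rewrite /b; lia.
  elim: k => [|k IH] lk.
    exists (upd R1 d.+2 0); split.
    + by exists 0.
    + split; last by rewrite upd_eq.
        by rewrite upd_neq ?k1 ?v2 //=; lia.
      by rewrite upd_neq ?v1 //; lia.
    + by move=> r lr; rewrite upd_neq; [rewrite k1 ?k2 //; lia|lia].
    + by move=> r; rewrite /upd; case: ifP.
  have [R' [r' [v' w' x'] k' l']] := IH (ltnW lk).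
  have lm3 i : scons d (scons d.+2 m) i < d.+3.
    by case: i => [|[|i]] /=; [lia|lia|have := lm i; lia].
  have eR3 i : R' (scons d (scons d.+2 m) i) = scons (iteri k F s2) (scons k rho) i.
    by case: i => [|[|i]] //=; rewrite k'.
  have R'0 : R' 0 = size w by rewrite k' //; have := lm 0; lia.
  have [R3 [r3 v3 k3 l3]] := H3 _ _ _ _ _ at3 lm3 eR3 R'0 l'.
  exists (upd (upd R3 d (R3 d.+3)) d.+2 k.+1); split.
  + rewrite mulSn addnC; apply: reaches_trans r' _; rewrite addnC.
    have r4 : reaches P w 1 (b, R') (b.+1, R').
      by apply: reaches_step atE _; rewrite /= x' w' ltn_eqF.
    have r5 : reaches P w 1 ((b.+1 + size c3)%N, R3)
        ((b.+1 + size c3).+1, upd R3 d (R3 d.+3)) by apply: reaches_step atC _.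
    have r6 : reaches P w 1 ((b.+1 + size c3).+1, upd R3 d (R3 d.+3))
        ((b.+1 + size c3).+2, upd (upd R3 d (R3 d.+3)) d.+2 k.+1).
      apply: reaches_step atD _ => /=; congr (_, upd _ _ _).
      by rewrite upd_neq ?k3 ?x' //; lia.
    have r7 : reaches P w 1 ((b.+1 + size c3).+2, upd (upd R3 d (R3 d.+3)) d.+2 k.+1)
        (b, upd (upd R3 d (R3 d.+3)) d.+2 k.+1).
      by apply: reaches_step atF _; rewrite /= eqxx.
    have [t' lt' et'] :=
      reaches_trans r4 (reaches_trans r3 (reaches_trans r5 (reaches_trans r6 r7))).
    by exists t'; [lia|].
  + split; [|by rewrite !upd_neq ?k3 //; lia|by rewrite upd_eq].
    by rewrite upd_neq ?upd_eq ?v3 //; lia.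
  + by move=> r lr; rewrite !upd_neq ?k3 ?k' //; lia.
  + move=> r; rewrite /upd; case: ifP => [_|_]; first lia.
    by case: ifP.
- exact: H1.
Qed.

(** * Closure properties of the functions computed by loop programs *)

(** The empty input is excluded because there every value is 0, so [true] cannot be returned. *)
Definition computable (F : seq bool -> (nat -> nat) -> nat) : Prop :=
  exists e, forall w rho, 0 < size w -> (forall i, rho i <= size w) -> eval w e rho = F w rho.

Definition decidable_in (P : seq bool -> (nat -> nat) -> bool) : Prop :=
  computable (fun w rho => P w rho : nat).

Local Notation cn := computable.
Local Notation cb := decidable_in.

Lemma leq_exp d a b : a <= b -> a ^ d <= b ^ d.
Proof. by move=> le; elim: d => // d IH; rewrite !expnS leq_mul. Qed.

Lemma in_P_decidable_in (P : seq bool -> bool) (L : seq bool -> Prop) :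
  cb (fun w _ => P w) -> ~~ P [::] -> (forall w, P w <-> L w) -> in_P L.
Proof.
move=> [e He] P0 PL; have [c [d Hc]] := cost_poly e.
pose code := compile e (fun=> 0) 1 0.
(* A nonzero result falls through to address [size Pr] and accepts; the result 0 jumps two addresses
   beyond it and rejects. *)
pose Pr := code ++ [:: Izero 2; Ieq 1 2 (size code + 4)].
apply: (@in_P_program Pr L (c * 2 ^ d + 2) d); first by rewrite size_cat addn2.
move=> w.
have [at1 at2] : code_at Pr 0 code /\ code_at Pr (0 + size code)
    [:: Izero 2; Ieq 1 2 (size code + 4)].
  by apply: code_at_cat; split.
have at3 := code_at_cons at2.
have [R [r v _ leR]] := @compileP Pr w e (fun=> 0) 1 0 (fun=> size w) (fun=> size w) at1
  (fun=> isT) (fun=> erefl) erefl (fun=> leqnn _).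
have r2 := reaches_trans r (reaches_trans (reaches_step at2 erefl) (reaches_step at3 erefl)).
have [t lt_ et] := r2; exists t; rewrite {}et /= upd_eq upd_neq // v.
split.
- apply: leq_trans lt_ _; have := Hc (size w).
  (* n + 1 is at most 2n unless n = 0, which the added 1 covers. *)
  have : (size w).+1 ^ d <= 2 ^ d * size w ^ d + 1.
    case: (size w) => [|n]; first by rewrite exp1n; lia.
    by apply: leq_trans (leq_addr _ _); rewrite -expnMn; apply: leq_exp; lia.
  have p2 : 0 < 2 ^ d by rewrite expn_gt0.
  move: (_.+1 ^ d) (size w ^ d) (2 ^ d) p2 (cost e _) => x y z p2 u h1 h2.
  have : c * x <= c * (z * y + 1) by rewrite leq_mul2l h1 orbT.
  nia.
- by rewrite size_cat /= add0n; case: ifP => _; lia.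
- have -> : (eval w e (fun=> size w) == 0) = ~~ P w.
    case: w {r r2 v leR lt_} => [|b w]; last by rewrite He //; case: (P _).
    by rewrite P0; apply/eqP; have := @eval_le [::] e (fun=> 0) (fun=> isT); case: eval.
  by rewrite size_cat /= add0n -PL; case: (P w) => /=; split=> //; lia.
Qed.

Lemma computable_ext F G :
  (forall w rho, 0 < size w -> (forall i, rho i <= size w) -> F w rho = G w rho) ->
  cn F -> cn G.
Proof. by move=> FG [e He]; exists e => w rho w0 le; rewrite He ?FG. Qed.

Lemma decidable_in_ext P Q :
  (forall w rho, 0 < size w -> (forall i, rho i <= size w) -> P w rho = Q w rho) ->
  cb P -> cb Q.
Proof. by move=> PQ; apply: computable_ext => w rho w0 le; rewrite PQ. Qed.

Lemma computable_le F w rho :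
  cn F -> 0 < size w -> (forall i, rho i <= size w) -> F w rho <= size w.
Proof. by move=> [e He] w0 le; rewrite -He // eval_le. Qed.

Lemma computable_var i : cn (fun w rho => rho i).
Proof. by exists (Var i). Qed.

Lemma computable_size : cn (fun w rho => size w).
Proof. by exists Full. Qed.

Lemma computable_succ F : cn F -> cn (fun w rho => minn (size w) (F w rho).+1).
Proof. by move=> [e He]; exists (Succ e) => w rho w0 le /=; rewrite He. Qed.

(** Registers cannot exceed the input length, so constants come truncated; this is the origin of
    [minn (size w)] in the decision procedure. *)
Lemma computable_const c : cn (fun w rho => minn (size w) c).
Proof.
elim: c => [|c IH]; first by exists Zero => w rho _ _; rewrite minn0.
by apply: computable_ext (computable_succ IH) => w rho _ _; lia.
Qed.

Lemma computable_weak f F : cn F -> cn (fun w rho => F w (fun i => rho (f i))).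
Proof. by move=> [e He]; exists (Weak f e) => w rho w0 le /=; rewrite He. Qed.

Lemma computable_let A B :
  cn A -> cn (fun w rho => B w (rho 0) (fun i => rho i.+1)) ->
  cn (fun w rho => B w (A w rho) rho).
Proof.
move=> cA [e2 H2]; have [e1 H1] := cA; exists (Let e1 e2) => w rho w0 le /=.
rewrite H2 //= ?H1 // => -[|i] //=; rewrite ?H1 //; exact: computable_le.
Qed.

Lemma computable_iter A B C :
  cn A -> cn (fun w rho => B w (rho 0) (rho 1) (fun i => rho i.+2)) -> cn C ->
  cn (fun w rho => iteri (A w rho) (fun i acc => B w acc i rho) (C w rho)).
Proof.
move=> cA cB cC; have [e1 H1] := cA; have [e2 H2] := cC; have [e3 H3] := cB.
exists (Loop e1 e2 e3) => w rho w0 le /=; rewrite H1 // H2 //.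
have := computable_le cA w0 le; move: (A w rho) => l ll.
suff [] : iteri l (fun i acc => eval w e3 (scons acc (scons i rho))) (C w rho) =
    iteri l (fun i acc => B w acc i rho) (C w rho) /\
    iteri l (fun i acc => B w acc i rho) (C w rho) <= size w by [].
elim: l ll => [|l IH] ll /=; first by split=> //; exact: computable_le.
have [-> le2] := IH (ltnW ll).
have le3 i : scons (iteri l (fun i acc => B w acc i rho) (C w rho)) (scons l rho) i <= size w.
  by case: i => [|[|i]] //=; exact: ltnW.
by rewrite H3 //=; split=> //; apply: (computable_le cB w0 le3).
Qed.

(** A conditional is a loop with the truth value as number of rounds: no round keeps the value of
    [B], one round replaces it by that of [A]. *)
Lemma computable_if P A B :
  cb P -> cn A -> cn B -> cn (fun w rho => if P w rho then A w rho else B w rho).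
Proof.
move=> cP cA cB; have := computable_iter (B := fun w _ _ rho => A w rho) cP _ cB.
move=> /(_ (computable_weak (fun i => i.+2) cA)).
by apply: computable_ext => w rho _ _; case: (P w rho).
Qed.

(** The predecessor is the number of the last round of a loop. *)
Lemma computable_pred A : cn A -> cn (fun w rho => (A w rho).-1).
Proof.
move=> cA; have := computable_iter (B := fun w _ i _ => i) cA (computable_var 1)
  (computable_const 0).
by apply: computable_ext => w rho _ _; case: (A w rho) => //=; rewrite minn0.
Qed.

Lemma computable_sub A B : cn A -> cn B -> cn (fun w rho => A w rho - B w rho).
Proof.
move=> cA cB; have := computable_iter (B := fun w a _ _ => a.-1) cB
  (computable_pred (computable_var 0)) cA.
apply: computable_ext => w rho _ _.
by elim: (B w rho) => [|b IH] /=; rewrite ?subn0 // IH; lia.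
Qed.

Lemma decidable_in_const b : cb (fun w rho => b).
Proof. by apply: computable_ext (computable_const b) => w rho w0 _; case: b; lia. Qed.

Lemma decidable_in_if P Q R : cb P -> cb Q -> cb R ->
  cb (fun w rho => if P w rho then Q w rho else R w rho).
Proof.
move=> cP cQ cR; apply: computable_ext (computable_if cP cQ cR) => w rho _ _.
by case: ifP.
Qed.

Lemma decidable_in_neg P : cb P -> cb (fun w rho => ~~ P w rho).
Proof. by move=> cP; apply: decidable_in_if cP (decidable_in_const _) (decidable_in_const _). Qed.

Lemma decidable_in_and P Q : cb P -> cb Q -> cb (fun w rho => P w rho && Q w rho).
Proof. by move=> cP cQ; apply: decidable_in_if cP cQ (decidable_in_const _). Qed.

Lemma decidable_in_or P Q : cb P -> cb Q -> cb (fun w rho => P w rho || Q w rho).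
Proof. by move=> cP cQ; apply: decidable_in_if cP (decidable_in_const _) cQ. Qed.

Lemma decidable_in_imp P Q : cb P -> cb Q -> cb (fun w rho => P w rho ==> Q w rho).
Proof. by move=> cP cQ; apply: decidable_in_if cP cQ (decidable_in_const _). Qed.

Lemma decidable_in_leq A B : cn A -> cn B -> cb (fun w rho => A w rho <= B w rho).
Proof.
move=> cA cB; have := computable_iter (B := fun w _ _ _ => minn (size w) 0)
  (computable_sub cA cB) (computable_const 0) (decidable_in_const true).
apply: computable_ext => w rho _ _; rewrite -subn_eq0.
by case: (_ - _) => //= n; rewrite minn0.
Qed.

Lemma decidable_in_lt A B : cn A -> cn B -> cb (fun w rho => A w rho < B w rho).
Proof.
move=> cA cB; apply: decidable_in_ext (decidable_in_neg (decidable_in_leq cB cA)) => w rho _ _.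
by rewrite ltnNge.
Qed.

Lemma decidable_in_eq A B : cn A -> cn B -> cb (fun w rho => A w rho == B w rho).
Proof.
move=> cA cB; have := decidable_in_and (decidable_in_leq cA cB) (decidable_in_leq cB cA).
by apply: decidable_in_ext => w rho _ _; rewrite eqn_leq.
Qed.

Lemma decidable_in_bit A : cn A -> cb (fun w rho => nth false w (A w rho)).
Proof.
move=> [e He]; exists (BitAt e) => w rho w0 le /=; rewrite He //.
by case: nth; lia.
Qed.

Lemma computable_add A B : cn A -> cn B -> cn (fun w rho => minn (size w) (A w rho + B w rho)).
Proof.
move=> cA cB; have := computable_iter (B := fun w a _ _ => minn (size w) a.+1) cB
  (computable_succ (computable_var 0)) cA.
apply: computable_ext => w rho w0 le; have := computable_le cA w0 le.
by elim: (B w rho) => [|b IH] leA /=; rewrite ?IH //; lia.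
Qed.

Lemma computable_mul A B : cn A -> cn B -> cn (fun w rho => minn (size w) (A w rho * B w rho)).
Proof.
move=> cA cB; have := computable_iter (B := fun w a _ rho => minn (size w) (a + A w rho)) cB
  (computable_add (computable_var 0) (computable_weak (fun i => i.+2) cA)) (computable_const 0).
apply: computable_ext => w rho w0 le; rewrite mulnC.
by elim: (B w rho) => [|b IH] /=; rewrite ?IH ?mulSn; lia.
Qed.

Lemma computable_count P A :
  cn A -> cb (fun w rho => P w (rho 0) (fun i => rho i.+1)) ->
  cn (fun w rho => count (fun x => P w x rho) (iota 0 (A w rho))).
Proof.
move=> cA cP.
have cP' : cb (fun w rho => P w (rho 1) (fun i => rho i.+2)) :=
  computable_weak (fun i => i.+1) cP.
have := computable_iter
  (B := fun w a x rho => if P w x rho then minn (size w) a.+1 else a) cA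
  (computable_if cP' (computable_succ (computable_var 0)) (computable_var 0)) (computable_const 0).
apply: computable_ext => w rho w0 le; have := computable_le cA w0 le.
elim: (A w rho) => [|a IH] la; first by rewrite /= minn0.
have -> : iota 0 a.+1 = iota 0 a ++ [:: a] by rewrite -addn1 iotaD.
rewrite count_cat [iteri _ _ _]/= IH; last exact: ltnW.
rewrite /= addn0.
have := count_size (fun x => P w x rho) (iota 0 a); rewrite size_iota.
by case: ifP => _; rewrite ?addn0 // addn1; lia.
Qed.

Lemma decidable_in_has P A :
  cn A -> cb (fun w rho => P w (rho 0) (fun i => rho i.+1)) ->
  cb (fun w rho => has (fun x => P w x rho) (iota 0 (A w rho))).
Proof.
move=> cA cP; have := decidable_in_lt (computable_const 0) (computable_count cA cP).
by apply: decidable_in_ext => w rho _ _; rewrite has_count minn0.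
Qed.

Lemma decidable_in_all P A :
  cn A -> cb (fun w rho => P w (rho 0) (fun i => rho i.+1)) ->
  cb (fun w rho => all (fun x => P w x rho) (iota 0 (A w rho))).
Proof.
move=> cA cP; have := decidable_in_neg
  (decidable_in_has (P := fun w x rho => ~~ P w x rho) cA (decidable_in_neg cP)).
by apply: decidable_in_ext => w rho _ _; rewrite (has_predC (fun x => P w x rho)) negbK.
Qed.

Fixpoint has_tuple (k m : nat) (P : pred (seq nat)) : bool :=
  if k is k'.+1 then has (fun x => has_tuple k' m (fun t => P (x :: t))) (iota 0 m)
  else P [::].

Lemma has_tupleP k m (P : pred (seq nat)) :
  reflect (exists t, [/\ size t = k, all (ltn^~ m) t & P t]) (has_tuple k m P).
Proof.
elim: k P => [|k IH] P /=.
  by apply: (iffP idP) => [p|[t [/size0nil-> _ p]] //]; exists [::].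
apply: (iffP hasP) => [[x]|[[|x t] [st lt_ p]] //].
  rewrite mem_iota /= add0n => lx /IH[t [st lt_ p]].
  by exists (x :: t); split=> //=; rewrite ?st ?lx.
move: st lt_ => /= [st] /andP[lx lt_].
by exists x; [rewrite mem_iota|apply/IH; exists t].
Qed.

(** As [k] is fixed, a tuple is held in the variables of [k] nested loops, with indices [ix].
    [NatTrec.add] is used because [NatTrec.add k.+1 i] is convertible to [NatTrec.add k i.+1], which
    is the shift made by the induction. *)
Lemma decidable_in_has_tuple k P A :
    cn A ->
    (forall ix, size ix = k ->
      cb (fun w rho => P w (map rho ix) (fun i => rho (NatTrec.add k i)))) ->
  cb (fun w rho => has_tuple k (A w rho) (fun t => P w t rho)).
Proof.
elim: k P A => [|k IH] P A cA cP /=; first exact: (cP [::]).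
apply: (decidable_in_has
  (P := fun w x rho => has_tuple k (A w rho) (fun t => P w (x :: t) rho))) => //.
apply: (IH (fun w t rho => P w (rho 0 :: t) (fun i => rho i.+1))
   (fun w rho => A w (fun i => rho i.+1))).
  exact: (computable_weak succn cA).
by move=> ix six; apply: (cP (NatTrec.add k 0 :: ix)); rewrite /= six.
Qed.

Lemma decidable_in_mem (T : seq bool -> (nat -> nat) -> nat -> nat) A ix :
  cn A -> (forall i, cn (fun w rho => T w rho i)) ->
  cb (fun w rho => A w rho \in map (T w rho) ix).
Proof.
move=> cA cT; elim: ix => [|i ix IH] /=; first exact: decidable_in_const.
apply: decidable_in_ext (decidable_in_or (decidable_in_eq cA (cT i)) IH) => w rho _ _.
by rewrite in_cons.
Qed.

(** * Possible sets of finalists *)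

(* [H] lists the first choices of the voters and [Z] pairs them with their parts. *)
Definition leads (m : nat) (Z : seq (nat * nat)) (i c : nat) : bool :=
  (c < m) && all (fun d => (d == c) || (count_mem (d, i) Z < count_mem (c, i) Z)) (iota 0 m).

Lemma leadsP m Z i c :
  reflect (c < m /\ forall d, d < m -> d <> c -> count_mem (d, i) Z < count_mem (c, i) Z)
    (leads m Z i c).
Proof.
apply: (iffP andP) => -[lc H]; split=> //.
  by move=> d ld ne; have /allP/(_ d) := H; rewrite mem_iota /= => /(_ ld)/orP[/eqP|].
by apply/allP => d; rewrite mem_iota /= => ld; case: eqP => //= ne; exact: H.
Qed.

Lemma leads_inj m Z i c d : leads m Z i c -> leads m Z i d -> c = d.
Proof.
move=> /leadsP[lc Hc] /leadsP[ld Hd]; case: (c =P d) => // ne.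
by have := Hc d ld (nesym ne); have := Hd c lc ne; lia.
Qed.

Lemma leads_tie m Z i M c d e :
    (forall a, a < m -> count_mem (a, i) Z <= M) -> c < m -> d < m -> c <> d ->
    M <= count_mem (c, i) Z -> M <= count_mem (d, i) Z -> ~~ leads m Z i e.
Proof.
move=> le lc ld ne Mc Md; apply/negP => /leadsP[le_ He].
have := le e le_; case: (c =P e) => [ce|ce].
  by have := He d ld ltac:(congruence); lia.
by have := He c lc ce; lia.
Qed.

Lemma sum_count_parts k c (H asg : seq nat) :
    size asg = size H -> all (ltn^~ k) asg ->
  \sum_(i < k) count_mem (c, val i) (zip H asg) = count_mem c H.
Proof.
elim: H asg => [|h H IH] [|a asg] //=; first by rewrite big1.
move=> [ss] /andP[la lasg]; rewrite big_split /= IH //; congr addn.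
rewrite (bigD1 (Ordinal la)) //= big1 => [|i ne].
  by rewrite addn0 xpair_eqE eqxx andbT.
by rewrite xpair_eqE; move: ne; rewrite -val_eqE /= eq_sym => /negbTE->; rewrite andbF.
Qed.

(** A vote lies in one part only, so it is counted at most once, and only if its first choice is the
    [f i] of that part. *)
Lemma sum_count_leaders k (f : nat -> nat) (H asg : seq nat) :
    size asg = size H ->
  \sum_(i < k) count_mem (f i, val i) (zip H asg) <=
  count (fun h => h \in map f (iota 0 k)) H.
Proof.
elim: H asg => [|h H IH] [|a asg] //=; first by rewrite big1.
move=> [ss]; rewrite big_split /= leq_add ?IH //.
case: (ltnP a k) => la; last first.
  rewrite big1 // => i _; rewrite xpair_eqE; have := ltn_ord i.
  by case: (a =P i) => [e|_]; rewrite ?andbF //; lia.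
rewrite (bigD1 (Ordinal la)) //= big1 => [|i ne].
  rewrite addn0 xpair_eqE eqxx andbT; case: eqP => [->|//].
  by rewrite map_f // mem_iota.
by rewrite xpair_eqE; move: ne; rewrite -val_eqE /= eq_sym => /negbTE->; rewrite andbF.
Qed.

(* A certificate that candidate [d] can be kept out of the final with finalists [t]:
   [t'] lists candidates able to win or tie the parts against [d]. *)
Definition blocked (k m : nat) (H t : seq nat) (d : nat) : Prop :=
  exists t', [/\ size t' = k, all (ltn^~ m) t', {subset t <= t'}, d \notin t' &
    count_mem d H + count (mem t) (iota 0 m) <= count (mem t') H].

(** In each part some candidate other than [d] has at least as many votes as [d], and one more if
    the part has a winner. At least |t| parts have one, and summing over the parts gives the
    inequality. *)
Lemma blocked_of_assignment k m (H asg : seq nat) p :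
    1 < m -> size asg = size H -> all (ltn^~ k) asg ->
    (exists2 i, i < k & leads m (zip H asg) i p) ->
  exists t, [/\ size t = k, all (ltn^~ m) t, all (fun c => 0 < count_mem c H) t,
    forall c, (c \in t) = has (fun i => leads m (zip H asg) i c) (iota 0 k) &
    forall d, d < m -> d \notin t -> blocked k m H t d].
Proof.
move=> m1 sH lasg [i0 li0 lead0]; set Z := zip H asg in lead0 *.
pose led i := has (leads m Z i) (iota 0 m).
pose f i := nth 0 (iota 0 m) (find (leads m Z i) (iota 0 m)).
have ledP i : led i -> leads m Z i (f i) by move=> h; exact: nth_find h.
have leadE i c : leads m Z i c -> led i /\ f i = c.
  move=> lc; have li : led i.
    by apply/hasP; exists c => //; have /leadsP[lcm _] := lc; rewrite mem_iota.
  by split=> //; apply: leads_inj (ledP _ li) lc.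
(* Parts without a winner contribute [p], which wins elsewhere, so that [t] has length exactly
   [k]. *)
pose t := [seq if led i then f i else p | i <- iota 0 k].
have memt c : (c \in t) = has (fun i => leads m Z i c) (iota 0 k).
  apply/mapP/hasP => [[i ik ->]|[i ik lc]].
    case: ifP => li; first by exists i => //; exact: ledP.
    by exists i0; rewrite ?mem_iota.
  by exists i => //; have [-> ->] := leadE _ _ lc.
have lt c : c \in t -> exists2 i, i < k & leads m Z i c.
  by rewrite memt => /hasP[i]; rewrite mem_iota => ik lc; exists i.
exists t; split=> //.
- by rewrite size_map size_iota.
- by apply/allP => c /lt[i _ /leadsP[]].
- apply/allP => c /lt[i ik /leadsP[lc Hc]].
  rewrite -(sum_count_parts c sH lasg) (bigD1 (Ordinal ik)) //=.
  apply: leq_trans (leq_addr _ _).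
  (* The boolean [c == 0], read as a number, is a candidate other than [c]; a winner has more votes
     than it, hence at least one. *)
  by apply: leq_ltn_trans (leq0n _) (Hc (c == 0) _ _); case: eqP; lia.
move=> d ld dt.
have notd i : i < k -> ~~ leads m Z i d.
  by move=> ik; apply: contra dt => lc; rewrite memt; apply/hasP; exists i; rewrite ?mem_iota.
pose over i e := (e != d) && (count_mem (d, i) Z <= count_mem (e, i) Z).
pose g i := if led i then f i else nth 0 (iota 0 m) (find (over i) (iota 0 m)).
have hasg i : i < k -> ~~ led i -> has (over i) (iota 0 m).
  move=> ik; apply: contraR => /hasPn no; exfalso; move: (notd i ik) => /leadsP[]; split=> //.
  move=> e le ne; have := no e; rewrite mem_iota /= => /(_ le); rewrite /over negb_and negbK.
  by case/orP=> [/eqP//|]; rewrite ltnNge.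
have gP i : i < k -> [/\ g i < m, g i <> d & count_mem (d, i) Z + led i <= count_mem (g i, i) Z].
  move=> ik; rewrite /g; case: ifP => li.
    have /leadsP[lf Hf] := ledP _ li.
    have ne : f i <> d by move=> e; have := notd i ik; rewrite -e ledP.
    by split=> //; have := Hf d ld (nesym ne); rewrite addn1.
  have hi := hasg i ik (negbT li).
  have /andP[/eqP ne le] := nth_find 0 hi; rewrite addn0; split=> //.
  by rewrite nth_iota; rewrite has_find size_iota in hi.
exists (map g (iota 0 k)); split.
- by rewrite size_map size_iota.
- by apply/allP => c /mapP[i]; rewrite mem_iota => ik ->; have [] := gP i ik.
- move=> c /lt[i ik lc]; have [li fi] := leadE _ _ lc.
  by apply/mapP; exists i; rewrite ?mem_iota // /g li.
- by apply/mapP => -[i]; rewrite mem_iota => ik e; have [_ []] := gP i ik.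
apply: leq_trans (sum_count_leaders k g sH).
apply: (@leq_trans (\sum_(i < k) (count_mem (d, val i) Z + led i))); last first.
  by apply: leq_sum => i _; have [] := gP i (ltn_ord i).
rewrite big_split /= sum_count_parts // leq_add2l.
have -> : \sum_(i < k) led i = count led (iota 0 k).
  rewrite -(big_mkord xpredT (fun i => nat_of_bool (led i))) -sum1_count.
  by rewrite [RHS]big_mkcond /index_iota subn0; apply: eq_bigr => i _; case: (led i).
rewrite -!size_filter -(size_map f [seq i <- iota 0 k | led i]); apply: uniq_leq_size.
  exact: filter_uniq (iota_uniq _ _).
move=> c; rewrite mem_filter /= => /andP[/lt[i ik lc] _]; have [li <-] := leadE _ _ lc.
by rewrite map_f // mem_filter li mem_iota.
Qed.

(** [L c] lists the parts intended for the votes with first choice [c]; going through [H], each vote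
    takes the head of its list. *)
Lemma exists_assignment k (L : nat -> seq nat) (H : seq nat) :
    (forall c, size (L c) = count_mem c H) -> (forall c, all (ltn^~ k) (L c)) ->
  exists asg, [/\ size asg = size H, all (ltn^~ k) asg &
    forall c i, count_mem (c, i) (zip H asg) = count_mem i (L c)].
Proof.
elim: H L => [|h H IH] L sL lL.
  by exists [::]; split=> // c i; have /size0nil-> := sL c.
have := sL h; rewrite /= eqxx; case Eh: (L h) => [//|a l] [sl].
have [c|c|asg [sa la ca]] := IH (fun c => if c == h then l else L c).
- by case: eqP => [->|/nesym/eqP/negbTE ne]; rewrite ?sL //= ne.
- by case: eqP => _ //; have := lL h; rewrite Eh => /andP[].
exists (a :: asg); split=> /=; rewrite ?sa //.
  by rewrite la andbT; have := lL h; rewrite Eh => /andP[].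
move=> c i; rewrite ca xpair_eqE eq_sym; case: eqP => [->|//].
by rewrite Eh.
Qed.

Lemma count_blocks (own g : nat -> nat) (E : seq nat) i :
  count_mem i (flatten [seq nseq (g e) (own e) | e <- E]) =
  \sum_(e <- E) (own e == i) * g e.
Proof.
elim: E => [|e E IH]; first by rewrite big_nil.
by rewrite big_cons /= count_cat count_nseq IH.
Qed.

(** Here [n] stands for the votes of [d], [g] for those of the blockers, [b] for the slots left by
    winners. Blockers are dropped from the front until [d] can match all the others. If any was
    dropped, [x] is what [d] has left, and the last one dropped has at least [x] votes. *)
Lemma choose_blockers (g : nat -> nat) (E : seq nat) n b :
    n <= \sum_(e <- E) g e + b ->
  exists E' x pre, [/\ E = pre ++ E', \sum_(e <- E') g e + x <= n,
    n <= x + \sum_(e <- E') g e + b &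
    x = 0 \/ exists e pre', pre = rcons pre' e /\ x <= g e].
Proof.
elim: E => [|e E IH] le; first by exists [::], 0, [::]; rewrite big_nil in le *; split=> //; left.
case: (leqP (\sum_(a <- e :: E) g a) n) => le2.
  by exists (e :: E), 0, [::]; split; rewrite ?addn0 //; left.
rewrite big_cons in le le2; case: (leqP (\sum_(a <- E) g a) n) => le3.
  exists E, (n - \sum_(a <- E) g a), [:: e]; split=> //; [lia|lia|].
  by right; exists e, [::]; split=> //; lia.
have [|E' [x [pre [eE h1 h2 h3]]]] := IH; first lia.
exists E', x, (e :: pre); split=> //; first by rewrite eE.
by case: h3 => [|[e' [pre' [-> le4]]]]; [left|right; exists e', (e :: pre')].
Qed.

(* Each [f] in [F] wins its own part; each [e] in [E] collects its own votes in its part,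
   where [d] ties with it, and [d] ties with a further candidate at [x] votes in one more
   part. All other candidates fill these slots in the same order, [x] first, then [E], and
   last the [nv f - 1] slots that each [f] leaves. *)
Lemma assignment_of_slots k m (H F E : seq nat) x (nv := fun c => count_mem c H) :
    1 < m -> uniq (F ++ E) -> all (ltn^~ m) (F ++ E) -> size (F ++ E) <= k ->
    (forall f, f \in F -> 0 < nv f) ->
    E = [::] /\ x = 0 \/ (exists d, [/\ d < m, d \notin F ++ E,
      \sum_(e <- E) nv e + x <= nv d &
      x = 0 \/ exists e, [/\ e < m, e \notin F ++ E, e <> d, x <= nv e & size (F ++ E) < k]]) ->
    (forall c, c \notin F ++ E -> nv c <= x + \sum_(e <- E) nv e + \sum_(f <- F) (nv f).-1) ->
  exists asg, [/\ size asg = size H, all (ltn^~ k) asg &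
    forall c, has (fun i => leads m (zip H asg) i c) (iota 0 k) = (c \in F)].
Proof.
move=> m1 uG lG sG posF hx cap; set G := F ++ E in uG lG sG hx cap *.
(* Members of [G] own the part numbered by their position; the tie at [x] votes uses part [size G],
   which must be below [k]. *)
pose own c := index c G.
pose B1 := nseq x (size G) ++ flatten [seq nseq (nv e) (own e) | e <- E].
pose B := B1 ++ flatten [seq nseq (nv f).-1 (own f) | f <- F].
pose L c := if c \in G then nseq (nv c) (own c) else take (nv c) B.
have size_blocks (g : nat -> nat) s :
    size (flatten [seq nseq (g e) (own e) | e <- s]) = \sum_(e <- s) g e.
  by elim: s => [|e s IH]; rewrite ?big_nil // big_cons /= size_cat size_nseq IH.
have sB1 : size B1 = x + \sum_(e <- E) nv e by rewrite size_cat size_nseq size_blocks.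
have sB : size B = x + \sum_(e <- E) nv e + \sum_(f <- F) (nv f).-1.
  by rewrite size_cat sB1 size_blocks.
have xk : x = 0 \/ size G < k.
  by case: hx => [[_]|[d [_ _ _ [|[e []]]]]]; auto.
have lB : all (ltn^~ k) B.
  have blk (g : nat -> nat) s : {subset s <= G} ->
      all (ltn^~ k) (flatten [seq nseq (g e) (own e) | e <- s]).
    move=> sub; apply/allP => i /flattenP[l /mapP[e es ->]] /nseqP[-> _] /=.
    by apply: leq_trans sG; rewrite index_mem sub.
  rewrite !all_cat !blk.
  - by rewrite !andbT; case: xk => [->//|lt_]; apply/allP => i /nseqP[->].
  - by move=> f fF; rewrite mem_cat fF.
  - by move=> e eE; rewrite mem_cat eE orbT.
have [c|c|asg [sa la ca]] := @exists_assignment k L H.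
- rewrite /L; case: ifP => cG; first by rewrite size_nseq.
  by rewrite size_take_min sB; apply/minn_idPl/cap; rewrite cG.
- rewrite /L; case: ifP => cG; last by apply/allP => i /mem_take /(allP lB).
  by apply/allP => i /nseqP[-> _] /=; apply: leq_trans sG; rewrite index_mem.
exists asg; split=> //; set Z := zip H asg in ca *.
have inG c i : c \in G -> count_mem (c, i) Z = (own c == i) * nv c.
  by move=> cG; rewrite ca /L cG count_nseq.
have leB c i : c \notin G -> count_mem (c, i) Z <= count_mem i B.
  move=> cG; rewrite ca /L (negbTE cG).
  by rewrite -{2}(cat_take_drop (nv c) B) count_cat leq_addr.
have geB c i n : c \notin G -> n <= nv c -> count_mem i (take n B) <= count_mem i (L c).
  move=> cG le; rewrite /L (negbTE cG).
  by rewrite -(cat_take_drop n (take (nv c) B)) take_takel // count_cat leq_addr.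
have blocks0 (g : nat -> nat) s i : (forall e, e \in s -> own e <> i) ->
    \sum_(e <- s) (own e == i) * g e = 0.
  by move=> ne; rewrite big_seq big1 // => e /ne/eqP/negbTE->.
have blocks1 (g : nat -> nat) s e0 : {subset s <= G} -> uniq s -> e0 \in s ->
    \sum_(e <- s) (own e == own e0) * g e = g e0.
  move=> sub us e0s; rewrite (bigD1_seq e0) //= eqxx mul1n big_seq_cond big1 ?addn0 //.
  move=> e /andP[es ne]; case: eqP => // eo; case/eqP: ne.
  by rewrite -(nth_index 0 (sub _ es)) -(nth_index 0 (sub _ e0s)); congr nth.
have subF : {subset F <= G} by move=> f fF; rewrite mem_cat fF.
have subE : {subset E <= G} by move=> f fE; rewrite mem_cat fE orbT.
have [uF /hasPn dis uE] : [/\ uniq F, ~~ has (mem F) E & uniq E].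
  by move: uG; rewrite cat_uniq => /and3P.
have ownG e : e \in G -> own e < size G by rewrite index_mem.
have own_inj e e' : e \in G -> e' \in G -> own e = own e' -> e = e'.
  by move=> eG e'G eo; rewrite -(nth_index 0 eG) -(nth_index 0 e'G); congr nth.
have leadF f : f \in F -> leads m Z (own f) f.
  move=> fF; apply/leadsP; split; first by apply: (allP lG); exact: subF.
  move=> d ld ne; rewrite (inG f) ?subF // eqxx mul1n.
  have [dG|dG] := boolP (d \in G).
    rewrite inG //; case: eqP => [eo|_]; last exact: posF.
    by case: ne; apply: own_inj eo => //; exact: subF.
  apply: leq_ltn_trans (leB _ _ dG) _; rewrite !count_cat count_nseq !count_blocks.
  rewrite (blocks1 (fun f => (nv f).-1) F) //.
  rewrite (blocks0 nv E) => [|e eE eo]; last first.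
    have ef : e = f by apply: own_inj eo; [exact: subE|exact: subF].
    by move: (dis e eE); rewrite /= ef fF.
  rewrite /= gtn_eqF ?ownG ?subF //=.
  by have := posF f fF; case: (nv f).
have noneE e c : e \in E -> ~~ leads m Z (own e) c.
  move=> eE; case: hx => [[E0]|[d [ld dG sd _]]]; first by rewrite E0 in eE.
  have bound : count_mem (own e) B = nv e.
    rewrite !count_cat count_nseq !count_blocks (blocks1 nv E) //.
    rewrite (blocks0 (fun f => (nv f).-1) F) => [|f fF eo]; last first.
      have ef : f = e by apply: own_inj eo; [exact: subF|exact: subE].
      by move: (dis e eE); rewrite /= -ef fF.
    by rewrite /= gtn_eqF ?ownG ?subE //= addn0.
  apply: (@leads_tie m Z (own e) (nv e) e d).
  - move=> a la'; have [aG|aG] := boolP (a \in G); last by rewrite -bound leB.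
    rewrite inG //; case: eqP => // eo; rewrite mul1n.
    by rewrite (own_inj a e aG (subE e eE) eo).
  - by apply: (allP lG); exact: subE.
  - exact: ld.
  - by move=> ed; move: dG; rewrite -ed subE.
  - by rewrite inG ?subE // eqxx mul1n.
  (* [d] has at least [size B1] votes and fills [B] in order, so it takes every slot in the part of
     [e]. *)
  rewrite ca; apply: leq_trans (geB d (own e) (size B1) dG _); last by rewrite sB1 addnC.
  rewrite take_size_cat // count_cat count_nseq count_blocks (blocks1 nv E) //.
  by rewrite leq_addl.
have nonerest i c : size G <= i -> ~~ leads m Z i c.
  move=> li; have bound : count_mem i B = (size G == i) * x.
    rewrite !count_cat count_nseq !count_blocks !blocks0 ?addn0 // => e eG eo.
      by have := ownG e (subF _ eG); lia.
    by have := ownG e (subE _ eG); lia.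
  have le a : a < m -> count_mem (a, i) Z <= (size G == i) * x.
    move=> la'; have [aG|aG] := boolP (a \in G); last by rewrite -bound leB.
    by rewrite inG //; case: eqP => // eo; have := ownG a aG; lia.
  case: (posnP ((size G == i) * x)) => [z|p].
    (* In a part without votes, candidates 0 and 1 tie at zero. *)
    by apply: (@leads_tie m Z i 0 0 1) => // [a /le|]; [rewrite z|lia].
  case: hx => [[_ x0]|[d [ld dG sd [x0|[e [le' eG ne xe lk]]]]]]; try by rewrite x0 muln0 in p.
  have ei : size G = i by move: p; case: eqP.
  have tie a : a \notin G -> x <= nv a -> (size G == i) * x <= count_mem (a, i) Z.
    move=> aG xa; rewrite ca; apply: leq_trans (geB a i x aG xa).
    by rewrite /B /B1 -catA take_size_cat ?size_nseq // count_nseq /= ei.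
  apply: (@leads_tie m Z i _ e d c le le' ld ne); apply: tie => //; lia.
move=> c; apply/hasP/idP => [[i _ lc]|cF]; last first.
  exists (own c); last exact: leadF.
  by rewrite mem_iota /=; apply: leq_trans sG; apply: ownG (subF _ cF).
case: (ltnP i (size G)) => [li|ge]; last by have := nonerest i c ge; rewrite lc.
have nG : nth 0 G i \in G by rewrite mem_nth.
have oi : own (nth 0 G i) = i by rewrite /own index_uniq.
move: nG; rewrite mem_cat => /orP[nF|nE]; last by have := noneE _ c nE; rewrite oi lc.
by have := leadF _ nF; rewrite oi => lf; rewrite (leads_inj lc lf).
Qed.

(** Only the certificate of the strongest outsider [d] is used: the others have at most as many
    votes, so they fit into slots that suffice for [d]. *)
Lemma assignment_of_blocked k m (H t : seq nat) :
    1 < m -> all (ltn^~ m) H -> size t = k -> all (ltn^~ m) t ->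
    all (fun c => 0 < count_mem c H) t ->
    (forall d, d < m -> d \notin t -> blocked k m H t d) ->
  exists asg, [/\ size asg = size H, all (ltn^~ k) asg &
    forall c, has (fun i => leads m (zip H asg) i c) (iota 0 k) = (c \in t)].
Proof.
move=> m1 lH st lt_ pos blk; pose nv c := count_mem c H; pose F := undup t.
have posF f : f \in F -> 0 < nv f by rewrite mem_undup => /(allP pos).
have nv0 c : m <= c -> nv c = 0.
  by move=> lc; apply/count_memPn; apply: contraL lc => /(allP lH); rewrite -ltnNge.
have sF : size F <= k by rewrite -st size_undup.
suff [E [x [uG lG sG hx cap]]] : exists E x, [/\ uniq (F ++ E), all (ltn^~ m) (F ++ E),
    size (F ++ E) <= k,
    E = [::] /\ x = 0 \/ (exists d, [/\ d < m, d \notin F ++ E,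
      \sum_(e <- E) nv e + x <= nv d &
      x = 0 \/ exists e, [/\ e < m, e \notin F ++ E, e <> d, x <= nv e & size (F ++ E) < k]]) &
    forall c, c \notin F ++ E -> nv c <= x + \sum_(e <- E) nv e + \sum_(f <- F) (nv f).-1].
  have [asg [sa la ca]] := assignment_of_slots m1 uG lG sG posF hx cap.
  by exists asg; split=> // c; rewrite ca mem_undup.
have lF : all (ltn^~ m) F by apply/allP => c; rewrite mem_undup => /(allP lt_).
have [all_t|] := boolP (all (mem t) (iota 0 m)).
  exists [::], 0; rewrite cats0 undup_uniq big_nil; split=> //; first by left.
  move=> c; rewrite mem_undup => ct; rewrite nv0 // leqNgt; apply: contra ct => lc.
  by apply: (allP all_t); rewrite mem_iota.
case/allPn => d0; rewrite mem_iota /= => ld0 d0t.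
have [d [ld dt dmax]] : exists d, [/\ d < m, d \notin t &
    forall c, c \notin t -> nv c <= nv d].
  have [d dt dmax] := @arg_maxnP _ (Ordinal ld0) (fun i : 'I_m => val i \notin t)
    (fun i => nv (val i)) d0t.
  exists d; split=> // c ct; case: (ltnP c m) => [lc|/nv0->//].
  exact: (dmax (Ordinal lc)).
have [t' [st' lt' sub dt' le]] := blk d ld dt.
pose E := [seq e <- undup t' | e \notin t].
have uFE : uniq (F ++ E).
  rewrite cat_uniq undup_uniq filter_uniq ?undup_uniq // andbT /=.
  by apply/hasPn => e; rewrite mem_filter /= => /andP[et _]; rewrite /F mem_undup.
have subFE : {subset F ++ E <= t'}.
  move=> e; rewrite mem_cat mem_filter !mem_undup => /orP[/sub//|/andP[]//].
have memFE e : e \in t' -> e \in F ++ E.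
  by move=> et; rewrite mem_cat mem_filter !mem_undup et; case: (e \in t).
have sFE : size (F ++ E) <= k by rewrite -st'; apply: uniq_leq_size.
have count_sum s : uniq s -> count (mem s) H = \sum_(e <- s) nv e.
  move=> us; rewrite /nv; elim: (H) => [|h H' IH] /=; first by rewrite big1.
  rewrite big_split /= -IH; congr addn.
  have [hs|hs] := boolP (h \in s).
    by rewrite (bigD1_seq h) //= eqxx big1 ?addn0 // => e; rewrite eq_sym => /negbTE->.
  by rewrite big_seq big1 // => e es; case: eqP => // he; rewrite he es in hs.
(* The term |t| is one vote per winner; moving it to the right turns the certificate into the slot
   count. *)
have le2 : nv d <= \sum_(e <- E) nv e + \sum_(f <- F) (nv f).-1.
  have e1 : count (mem t') H = \sum_(f <- F) nv f + \sum_(e <- E) nv e.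
    rewrite -big_cat /= -count_sum //; apply: eq_count => e /=.
    by apply/idP/idP => [/memFE|/subFE].
  have e2 : \sum_(f <- F) nv f = \sum_(f <- F) (nv f).-1 + size F.
    rewrite -sum1_size -big_split /=; apply: eq_big_seq => f /posF; rewrite addn1.
    by case: (nv f).
  have e3 : count (mem t) (iota 0 m) = size F.
    rewrite -size_filter; apply/perm_size/uniq_perm; rewrite ?filter_uniq ?iota_uniq ?undup_uniq //.
    move=> c; rewrite mem_filter mem_iota mem_undup /= andbC.
    by case: (ltnP c m) => //= lc; apply/esym/negbTE; apply: contraL lc;
       move/(allP lt_); rewrite -ltnNge.
  by move: le; rewrite e1 e2 e3 -/(nv d); lia.
have [E' [x [pre [eE h1 h2 h3]]]] := choose_blockers le2.
have subE' : {subset F ++ E' <= F ++ E}.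
  by move=> e; rewrite eE !mem_cat => /orP[->//|->]; rewrite !orbT.
have uG : uniq (F ++ E').
  by apply: subseq_uniq uFE; rewrite eE; apply: cat_subseq => //; exact: suffix_subseq.
exists E', x; split=> //.
- by apply/allP => e /subE'/subFE/(allP lt').
- exact: leq_trans (uniq_leq_size uG subE') sFE.
- right; exists d; split=> //.
    by apply/negP => /subE'/subFE; apply/negP.
  case: h3 => [|[e [pre' [epre xe]]]]; [by left|right].
  have eFE : e \in F ++ E by rewrite eE epre !mem_cat mem_rcons mem_head !orbT.
  (* The dropped blocker [e] was counted in [F ++ E], so its removal frees a part for the tie at [x]
     votes. *)
  have ueG : uniq (e :: F ++ E').
    rewrite -[_ :: _]/([:: e] ++ F ++ E') uniq_catCA.
    apply: subseq_uniq uFE; rewrite eE epre cat_rcons; apply: cat_subseq => //.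
    exact: suffix_subseq.
  exists e; split=> //.
  + by have /subFE/(allP lt') := eFE.
  + by case/andP: ueG.
  + by move=> ed; move: dt'; rewrite -ed (subFE _ eFE).
  apply: leq_trans sFE; apply: (@uniq_leq_size _ (e :: F ++ E')) => // a.
  by rewrite inE => /orP[/eqP->|/subE'].
move=> c; rewrite mem_cat mem_undup negb_or => /andP[ct _].
exact: leq_trans (dmax c ct) h2.
Qed.

(** * From elections to sequences of first choices *)

Lemma top_in_all m v : perm_eq v (iota 0 m) -> top_in (iota 0 m) v = ohead v.
Proof.
move=> pv; rewrite /top_in (_ : [seq c <- v | _] = v) //.
by apply/all_filterP/allP => c; rewrite (perm_mem pv).
Qed.

Lemma pscore_part m V asg i c :
    0 < m -> all (fun v => perm_eq v (iota 0 m)) V ->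
  pscore (iota 0 m) (part V asg i) c = count_mem (c, i) (zip (map (head 0) V) asg).
Proof.
move=> m0; rewrite /part /pscore; elim: V asg => [|v V IH] [|a asg] //= /andP[pv pV].
rewrite [in RHS]xpair_eqE -IH //; have tv := top_in_all pv.
have -> : (head 0 v == c) = (top_in (iota 0 m) v == Some c).
  rewrite tv; case: v pv {tv} => [|h v] // /perm_size /=; rewrite size_iota; lia.
by case: (a == i); rewrite /= ?andbT ?andbF.
Qed.

Lemma unique_winner_part m V asg i c :
    0 < m -> all (fun v => perm_eq v (iota 0 m)) V ->
  unique_winner (iota 0 m) (part V asg i) c = leads m (zip (map (head 0) V) asg) i c.
Proof.
move=> m0 pV; rewrite /unique_winner /leads mem_iota /=; congr andb.
by apply: eq_all => d; rewrite !pscore_part.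
Qed.

(** Needed because a tuple [t] may repeat candidates and list them in any order, unlike
    [finalists]. *)
Lemma eq_unique_winner D D' U c : D =i D' -> unique_winner D U c = unique_winner D' U c.
Proof.
move=> eD; rewrite /unique_winner eD (eq_all_r eD); congr andb; apply: eq_all => d.
have e a : pscore D U a = pscore D' U a.
  by apply: eq_count => v; rewrite /top_in (eq_filter eD).
by rewrite !e.
Qed.

Lemma mem_finalists m k V asg c :
    0 < m -> all (fun v => perm_eq v (iota 0 m)) V ->
  (c \in finalists m k V asg) =
  has (fun i => leads m (zip (map (head 0) V) asg) i c) (iota 0 k).
Proof.
move=> m0 pV; rewrite mem_filter mem_iota /=.
rewrite (eq_has (a2 := fun i => leads m (zip (map (head 0) V) asg) i c)); last first.
  by move=> i; rewrite unique_winner_part.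
by apply/andb_idr => /hasP[i _ /leadsP[]].
Qed.

(** A sole candidate wins even an empty part, so the answer is yes even without voters, when no
    candidate has a positive number of first places. *)
Lemma ccpv_te_yes_one_candidate k I :
  0 < k -> valid_instance I -> ncand I = 1 -> ccpv_te_yes k I.
Proof.
case: I => m V p /= k0 /andP[/= lp pV] m1; rewrite m1 in lp pV *.
have p0 : p = 0 by lia.
exists (nseq (size V) 0); rewrite size_nseq; split=> //=.
  by apply/allP => a /nseqP[->].
rewrite p0 (@eq_unique_winner _ [:: 0]) // => c.
rewrite mem_finalists // inE; apply/hasP/eqP => [[i _ /leadsP[]]|->]; first by lia.
exists 0; first by rewrite mem_iota.
by apply/leadsP; split=> // d; lia.
Qed.

(** The final depends only on the set of finalists, so the question splits into the final itself and
    the realizability of [t] in the first round. *)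
Lemma ccpv_te_yesP k I (H := map (head 0) (votes I)) :
    0 < k -> valid_instance I -> 1 < ncand I ->
  ccpv_te_yes k I <-> exists t, [/\ size t = k, all (ltn^~ (ncand I)) t,
    all (fun c => 0 < count_mem c H) t, unique_winner t (votes I) (dist I) &
    forall d, d < ncand I -> d \notin t -> blocked k (ncand I) H t d].
Proof.
case: I @H => m V p H /= k0 /andP[/= lp pV] m1; have m0 := ltnW m1; split.
  move=> [asg [sa la win]]; have sH : size asg = size H by rewrite sa size_map.
  have := win; rewrite /unique_winner => /andP[pfin _].
  have [|t [st lt_ pos memt blk]] := @blocked_of_assignment k m H asg p m1 sH la.
    by move: pfin; rewrite mem_finalists // => /hasP[i]; rewrite mem_iota => li; exists i.
  exists t; split=> //; rewrite -/(unique_winner t V p).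
  rewrite (@eq_unique_winner t (finalists m k V asg)) // => c.
  by rewrite mem_finalists // memt.
move=> [t [st lt_ pos win blk]].
have lH : all (ltn^~ m) H.
  apply/allP => h /mapP[v vV ->]; have pv := allP pV v vV.
  have : head 0 v \in v.
    by case: (v) pv => [|c v'] // /perm_size; rewrite ?size_iota ?mem_head //=; lia.
  by rewrite (perm_mem pv) mem_iota.
have [asg [sa la mema]] := assignment_of_blocked m1 lH st lt_ pos blk.
exists asg; rewrite sa size_map; split=> //.
by rewrite (@eq_unique_winner _ t) // => c; rewrite mem_finalists.
Qed.

(** * Reading the encoding *)

Definition zeros_before (w : seq bool) (x : nat) : nat :=
  count (fun y => ~~ nth false w y) (iota 0 x).

(* Trailing [true]s count as a last block, so [w] is a sequence of complete blocks iff
   the block numbered by its number of [false]s is 0. *)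
Definition block (w : seq bool) (j : nat) : nat :=
  count (fun x => nth false w x && (zeros_before w x == j)) (iota 0 (size w)).

Lemma zeros_before_cat u v x : zeros_before (u ++ v) (size u + x) =
  zeros_before u (size u) + zeros_before v x.
Proof.
rewrite /zeros_before iotaD count_cat add0n; congr addn.
  by apply: eq_in_count => y; rewrite mem_iota nth_cat /= => ->.
rewrite -[X in iota X _]addn0 iotaDl count_map; apply: eq_count => y /=.
by rewrite nth_cat ltnNge leq_addr addKn.
Qed.

Lemma block_cat u v j :
  block (u ++ v) j = block u j +
    (if zeros_before u (size u) <= j then block v (j - zeros_before u (size u)) else 0).
Proof.
rewrite /block size_cat iotaD count_cat add0n; congr addn.
  apply: eq_in_count => y; rewrite mem_iota nth_cat /= => ly; rewrite ly.
  congr (_ && (_ == _)); apply: eq_in_count => z; rewrite mem_iota nth_cat /= => lz.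
  by rewrite (ltn_trans lz ly).
rewrite -[X in iota X _]addn0 iotaDl count_map; case: ifP => le.
  apply: eq_count => y /=; rewrite zeros_before_cat nth_cat ltnNge leq_addr addKn /=.
  by congr andb; lia.
apply/eqP; rewrite -leqn0 leqNgt -has_count; apply/hasPn => y _ /=.
rewrite zeros_before_cat negb_and; apply/orP; right; lia.
Qed.

Lemma zeros_before_nseq n x : x <= n -> zeros_before (nseq n true) x = 0.
Proof.
move=> le; apply/eqP; rewrite -leqn0 leqNgt -has_count; apply/hasPn => y.
by rewrite mem_iota /= nth_nseq => ly; rewrite (leq_trans ly le).
Qed.

Lemma block_nseq n j : block (nseq n true) j = if j == 0 then n else 0.
Proof.
rewrite /block size_nseq.
rewrite (@eq_in_count _ _ (fun=> j == 0)) => [|x]; last first.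
  by rewrite mem_iota /= => lx; rewrite nth_nseq lx zeros_before_nseq 1?ltnW // eq_sym.
by case: (j == 0); rewrite ?count_predT ?count_pred0 ?size_iota.
Qed.

Lemma zeros_before_enc_nat n : zeros_before (enc_nat n) (size (enc_nat n)) = 1.
Proof.
rewrite /enc_nat -cats1 size_cat zeros_before_cat size_nseq zeros_before_nseq //.
Qed.

Lemma block_enc_nat n j : block (enc_nat n) j = if j == 0 then n else 0.
Proof.
rewrite /enc_nat -cats1 block_cat block_nseq size_nseq zeros_before_nseq //= subn0.
by rewrite /block /= !addn0.
Qed.

Definition enc_nats (s : seq nat) : seq bool := flatten (map enc_nat s).

Lemma zeros_enc_nats s r :
  zeros_before (enc_nats s ++ nseq r true) (size (enc_nats s ++ nseq r true)) = size s.
Proof.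
elim: s => [|n s IH]; first by rewrite size_nseq zeros_before_nseq.
by rewrite /enc_nats /= -catA size_cat zeros_before_cat zeros_before_enc_nat IH.
Qed.

Lemma block_enc_nats s r j :
  block (enc_nats s ++ nseq r true) j = nth 0 (rcons s r) j.
Proof.
elim: s j => [|n s IH] j; first by rewrite block_nseq; case: j => [|[]].
rewrite /enc_nats /= -catA block_cat block_enc_nat zeros_before_enc_nat.
by case: j => [|j] /=; rewrite ?addn0 // subn1 IH.
Qed.

(** Malformed inputs are covered too: any bit string is a list of complete blocks followed by [r]
    stray [true]s. *)
Lemma parse w : exists s r, w = enc_nats s ++ nseq r true.
Proof.
elim: w => [|[] w [s [r ->]]]; first by exists [::], 0.
  by case: s => [|n s]; [exists [::], r.+1|exists (n.+1 :: s), r].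
by exists (0 :: s), r.
Qed.

(** A block consists of [true]s, disjoint from the [false]s counted on the left. The bound shows
    that truncations are inactive on encodings. *)
Lemma zeros_block_le w j : zeros_before w (size w) + block w j <= size w.
Proof.
have := count_predC (nth false w) (iota 0 (size w)); rewrite size_iota.
move=> e; rewrite -[X in _ <= X]e addnC leq_add2r.
by apply: sub_count => x /andP[].
Qed.

Definition enc_list (I : instance) : seq nat :=
  [:: ncand I, dist I, size (votes I) & flatten (votes I)].

Lemma enc_instanceE I : enc_instance I = enc_nats (enc_list I).
Proof.
rewrite /enc_instance /enc_nats /=; do 3 congr cat.
by elim: (votes I) => //= v V ->; rewrite map_cat flatten_cat.
Qed.

Lemma nth_flatten_uniform m (V : seq (seq nat)) j i :
    all (fun v => size v == m) V -> j < size V -> i < m ->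
  nth 0 (flatten V) (j * m + i) = nth 0 (nth [::] V j) i.
Proof.
elim: V j => [|v V IH] [|j] //= /andP[/eqP sv sV] lj li; rewrite nth_cat sv; first by rewrite li.
by rewrite mulSn -addnA ltnNge leq_addr addKn IH.
Qed.

Lemma size_flatten_uniform m (V : seq (seq nat)) :
  all (fun v => size v == m) V -> size (flatten V) = size V * m.
Proof. by elim: V => //= v V IH /andP[/eqP sv /IH e]; rewrite size_cat sv e. Qed.

Definition candidates w := block w 0.
Definition preferred w := block w (minn (size w) 1).
Definition voters w := block w (minn (size w) 2).

(* The [i]-th candidate of the [j]-th vote; the truncations are harmless on encodings. *)
Definition entry w j i :=
  block w (minn (size w) (minn (size w)
    (minn (size w) 3 + minn (size w) (j * candidates w)) + i)).

(** The second conjunct forbids stray [true]s at the end. The last one makes each vote a permutation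
    by pigeonhole: it has [candidates w] entries, among which all candidates occur. *)
Definition well_formed w :=
  [&& preferred w < candidates w, block w (zeros_before w (size w)) == 0,
      zeros_before w (size w) ==
        minn (size w) (minn (size w) 3 + minn (size w) (voters w * candidates w)) &
      all (fun j => all (fun c => has (fun i => entry w j i == c)
        (iota 0 (candidates w))) (iota 0 (candidates w))) (iota 0 (voters w))].

Section Decoding.
Variable I : instance.
Hypothesis votes_size : all (fun v => size v == ncand I) (votes I).
Let w := enc_instance I.

Lemma block_enc j : block w j = nth 0 (enc_list I) j.
Proof.
have := block_enc_nats (enc_list I) 0 j; rewrite cats0 -enc_instanceE -/w => ->.
rewrite nth_rcons; case: ltngtP => // [lt_|->]; rewrite nth_default //; exact: ltnW.
Qed.

Lemma zeros_enc : zeros_before w (size w) = 3 + size (votes I) * ncand I.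
Proof.
have := zeros_enc_nats (enc_list I) 0; rewrite cats0 -enc_instanceE -/w => ->.
by rewrite /= (size_flatten_uniform votes_size).
Qed.

Lemma size_enc : 3 + size (votes I) * ncand I <= size w.
Proof. by rewrite -zeros_enc; have := zeros_block_le w 0; lia. Qed.

Lemma candidates_enc : candidates w = ncand I.
Proof. by rewrite /candidates block_enc. Qed.

Lemma preferred_enc : preferred w = dist I.
Proof. by rewrite /preferred (minn_idPr _) ?block_enc //; have := size_enc; lia. Qed.

Lemma voters_enc : voters w = size (votes I).
Proof. by rewrite /voters (minn_idPr _) ?block_enc //; have := size_enc; lia. Qed.

Lemma entry_enc j i : j < size (votes I) -> i < ncand I ->
  entry w j i = nth 0 (nth [::] (votes I) j) i.
Proof.
move=> lj li; rewrite -(nth_flatten_uniform votes_size lj li) /entry candidates_enc.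
have := size_enc => le.
have le2 : j * ncand I + ncand I <= size (votes I) * ncand I.
  by rewrite addnC -mulSn leq_mul2r lj orbT.
rewrite (_ : minn _ _ = 3 + (j * ncand I + i)); first by rewrite block_enc.
lia.
Qed.

Lemma well_formed_enc : valid_instance I -> well_formed w.
Proof.
have le := size_enc => /andP[lp pV].
apply/and4P; split; first by rewrite preferred_enc candidates_enc.
- by rewrite zeros_enc block_enc nth_default //= (size_flatten_uniform votes_size).
- rewrite zeros_enc voters_enc candidates_enc; apply/eqP.
  by move: (_ * _) le => x; lia.
rewrite voters_enc candidates_enc; apply/allP => j; rewrite mem_iota /= => lj.
apply/allP => c; rewrite mem_iota /= => lc; apply/hasP.
have pj := allP pV _ (mem_nth [::] lj).
have cj : c \in nth [::] (votes I) j by rewrite (perm_mem pj) mem_iota.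
have li : index c (nth [::] (votes I) j) < ncand I.
  by rewrite -[ncand I](size_iota 0) -(perm_size pj) index_mem.
exists (index c (nth [::] (votes I) j)); first by rewrite mem_iota.
by rewrite entry_enc // nth_index.
Qed.
End Decoding.

Lemma valid_votes_size I :
  valid_instance I -> all (fun v => size v == ncand I) (votes I).
Proof. by case/andP=> _; apply: sub_all => v /perm_size ->; rewrite size_iota. Qed.

Lemma well_formedP w : well_formed w -> exists2 I, valid_instance I & enc_instance I = w.
Proof.
case/and4P => lp b0 zE vE; have [s [r ew]] := parse w.
have le := zeros_block_le w 0; rewrite -/(candidates w) in le.
have zs : zeros_before w (size w) = size s by rewrite ew zeros_enc_nats.
have bE j : block w j = nth 0 (rcons s r) j by rewrite ew block_enc_nats.
have r0 : r = 0 by move: b0; rewrite zs bE nth_rcons ltnn eqxx => /eqP.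
have sE : size s = 3 + voters w * candidates w.
  (* [candidates w] is positive, so the number of blocks is strictly below [size w]; the truncated
     count that it equals is then exact. *)
  by move: zE; rewrite zs => /eqP; move: le lp; rewrite zs; move: (_ * _) => x; lia.
have n3 : 3 <= size w by move: le; rewrite zs sE; lia.
have es : exists m p N rest, s = [:: m, p, N & rest].
  by case: (s) sE => [|m [|p [|N rest]]] // _; exists m, p, N, rest.
have [m [p [N [rest {}es]]]] := es.
have mE : candidates w = m by rewrite /candidates bE es.
have NE : voters w = N by rewrite /voters (minn_idPr (ltnW n3)) bE es.
have srest : size rest = m * N by move: sE; rewrite es NE mE /=; lia.
pose I := Instance m (reshape (nseq N m) rest) p.
have fl : flatten (votes I) = rest by rewrite reshapeKr // sumn_nseq srest.
have sV : size (votes I) = N by rewrite size_reshape size_nseq.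
have szV : all (fun v => size v == ncand I) (votes I).
  rewrite -(all_map size (pred1 m)) -/(shape _) reshapeKl ?sumn_nseq ?srest //.
  by rewrite all_nseq /= eqxx orbT.
have eI : enc_instance I = w by rewrite enc_instanceE /enc_list fl sV -es ew r0 cats0.
exists I => //; apply/andP; split.
  by rewrite -(preferred_enc szV) -(candidates_enc I) eI.
apply/allP => v /(nthP [::])[j lj <-].
have sv : size (nth [::] (votes I) j) = ncand I by apply/eqP/(allP szV)/mem_nth.
have sub : {subset iota 0 (ncand I) <= nth [::] (votes I) j}.
  move=> c; rewrite mem_iota /= => lc.
  move: vE; rewrite -eI (voters_enc szV) (candidates_enc I) => /allP/(_ j).
  rewrite mem_iota => /(_ lj)/allP/(_ c); rewrite mem_iota => /(_ lc)/hasP[i].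
  by rewrite mem_iota => li /eqP <-; rewrite (entry_enc szV) // mem_nth // sv.
have szle : size (nth [::] (votes I) j) <= size (iota 0 (ncand I)) by rewrite sv size_iota.
apply: uniq_perm; rewrite ?iota_uniq //; first exact: leq_size_uniq (iota_uniq _ _) sub szle.
by move=> c; have [_ ->] := uniq_min_size (iota_uniq _ _) sub szle.
Qed.

(** * The decision procedure and its correctness *)

Definition top_votes w c := count (fun j => entry w j 0 == c) (iota 0 (voters w)).

(** Stated by positions, to use bounded quantifiers only; it agrees with [pscore] for [c] in [t]. *)
Definition final_score w (t : seq nat) c :=
  count (fun j => has (fun i => (entry w j i == c) &&
    all (fun i' => entry w j i' \notin t) (iota 0 i)) (iota 0 (candidates w)))
    (iota 0 (voters w)).

Definition blockedb k w (t : seq nat) d :=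
  has_tuple k (candidates w) (fun t' =>
    [&& all (fun c => (c \in t) ==> (c \in t')) (iota 0 (candidates w)), d \notin t' &
        minn (size w) (top_votes w d + count (fun c => c \in t) (iota 0 (candidates w))) <=
        count (fun j => entry w j 0 \in t') (iota 0 (voters w))]).

Definition ccpv_te_decider k w :=
  well_formed w && ((candidates w <= minn (size w) 1) ||
    has_tuple k (candidates w) (fun t =>
      [&& preferred w \in t,
          all (fun c => (c \in t) ==> (0 < top_votes w c) &&
             ((c == preferred w) || (final_score w t c < final_score w t (preferred w))))
            (iota 0 (candidates w)) &
          all (fun d => (d \in t) || blockedb k w t d) (iota 0 (candidates w))])).

Lemma count_nth (T : Type) (x0 : T) (P : pred T) s :
  count (fun j => P (nth x0 s j)) (iota 0 (size s)) = count P s.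
Proof. by rewrite -[in RHS](mkseq_nth x0 s) count_map. Qed.

Lemma top_inP (t v : seq nat) c : c \in t ->
  (top_in t v == Some c) =
  has (fun i => (nth 0 v i == c) && all (fun i' => nth 0 v i' \notin t) (iota 0 i))
    (iota 0 (size v)).
Proof.
move=> ct; elim: v => [|h v IH] //; rewrite /top_in /=.
rewrite -[iota 1 _]/(iota (1 + 0) _) iotaDl has_map.
case: (boolP (h \in t)) => ht.
  rewrite andbT (_ : has _ _ = false) ?orbF //.
  by apply/negbTE/hasPn => i _ /=; rewrite ht andbF.
rewrite -/(top_in t v) IH (_ : h == c = false) /=; last by apply: contraNF ht => /eqP->.
apply: eq_has => i /=; rewrite ht -[iota 1 _]/(iota (1 + 0) _) iotaDl all_map.
by congr andb; apply: eq_all.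
Qed.

Section DeciderOnEncodings.
Variables (k : nat) (I : instance).
Hypotheses (k0 : 0 < k) (vI : valid_instance I).
Let w := enc_instance I.
Let H := map (head 0) (votes I).

Lemma top_votes_enc (P : pred nat) : 0 < ncand I ->
  count (fun j => P (entry w j 0)) (iota 0 (voters w)) = count P H.
Proof.
move=> m0; have sI := valid_votes_size vI; rewrite /w (voters_enc sI) /H count_map.
rewrite -(count_nth [::] _ (votes I)); apply: eq_in_count => j; rewrite mem_iota /= => lj.
by rewrite entry_enc // nth0.
Qed.

Lemma final_score_enc (t : seq nat) c : c \in t -> final_score w t c = pscore t (votes I) c.
Proof.
move=> ct; have sI := valid_votes_size vI.
rewrite /final_score /w (voters_enc sI) (candidates_enc I).
rewrite /pscore -(count_nth [::]); apply: eq_in_count => j; rewrite mem_iota /= => lj.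
have sv : size (nth [::] (votes I) j) = ncand I by apply/eqP/(allP sI)/mem_nth.
rewrite top_inP // sv; apply: eq_in_has => i; rewrite mem_iota /= => li.
rewrite entry_enc //; congr andb; apply: eq_in_all => i'; rewrite mem_iota /= => li'.
by rewrite entry_enc // (ltn_trans li' li).
Qed.

Lemma all_iota_ltP m (P : pred nat) : reflect (forall c, c < m -> P c) (all P (iota 0 m)).
Proof.
by apply: (iffP allP) => h c; [move=> lc; apply: h; rewrite mem_iota|rewrite mem_iota => /h].
Qed.

Lemma blockedbP t d : all (ltn^~ (ncand I)) t -> d < ncand I ->
  reflect (blocked k (ncand I) H t d) (blockedb k w t d).
Proof.
move=> lt_ ld; have m0 : 0 < ncand I by lia.
have sI := valid_votes_size vI; have le := size_enc sI; rewrite -/w in le.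
have cw : candidates w = ncand I := candidates_enc I.
have tv c : top_votes w c = count_mem c H := top_votes_enc (pred1 c) m0.
have sH : count (mem t) (iota 0 (ncand I)) <= ncand I.
  by rewrite -[X in _ <= X](size_iota 0) count_size.
apply: (iffP (has_tupleP _ _ _)) => -[t' []]; rewrite cw => st' lt'.
  case/and3P => /all_iota_ltP sub dt' cnt; exists t'; split=> //.
    by move=> c ct; move: (sub c (allP lt_ c ct)); rewrite ct.
  move: cnt; rewrite tv (top_votes_enc (mem t') m0) => cnt.
  have {cnt} : minn (size w) (count_mem d H + count (mem t) (iota 0 (ncand I))) <=
    count (mem t') H by [].
  (* There are fewer votes than bits, so a truncated left-hand side could not be below this count:
     the inequality holds without truncation. *)
  have : count (mem t') H < size w.
    apply: leq_trans le; apply: leq_ltn_trans (count_size _ _) _; rewrite size_map.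
    by apply: leq_ltn_trans (leq_pmulr _ m0) _; rewrite -[X in X < _]add0n ltn_add2r.
  by rewrite geq_min => /ltn_geF ->.
move=> sub dt' cnt; exists t'; split=> //; apply/and3P; split=> //.
  by apply/all_iota_ltP => c _; apply/implyP/sub.
rewrite tv (top_votes_enc (mem t') m0); exact: leq_trans (geq_minr _ _) cnt.
Qed.

Lemma decider_enc : ccpv_te_decider k w <-> ccpv_te_yes k I.
Proof.
have sI := valid_votes_size vI; have le := size_enc sI; rewrite -/w in le.
have /andP[lp _] := vI; have m0 : 0 < ncand I by lia.
have cw : candidates w = ncand I := candidates_enc I.
have tv c : top_votes w c = count_mem c H := top_votes_enc (pred1 c) m0.
rewrite /ccpv_te_decider (well_formed_enc sI vI : well_formed w) /= cw.
rewrite (preferred_enc sI : preferred w = dist I).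
rewrite (minn_idPr _ : minn (size w) 1 = 1); last by lia.
case: (ltnP 1 (ncand I)) => m1; last first.
  by split=> // _; apply: ccpv_te_yes_one_candidate => //; lia.
rewrite /= ccpv_te_yesP //; apply: (iff_trans (iff_sym (rwP (has_tupleP _ _ _)))).
have memP t c : all (ltn^~ (ncand I)) t -> c \in t -> c < ncand I by move/allP; exact.
split=> -[t] [st lt_].
  case/and3P => pt /all_iota_ltP posw /all_iota_ltP blk; exists t; split=> //.
  - apply/allP => c ct; have := posw c (memP _ _ lt_ ct); rewrite ct /= => /andP[].
    by rewrite tv.
  - apply/andP; split=> //; apply/allP => c ct; have := posw c (memP _ _ lt_ ct).
    by rewrite ct /= !final_score_enc // => /andP[].
  by move=> d ld dt; apply/blockedbP => //; have := blk d ld; rewrite (negbTE dt).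
move=> pos /andP[pt win] blk; exists t; split=> //; apply/and3P; split=> //.
  apply/all_iota_ltP => c _; apply/implyP => ct; rewrite tv.
  by rewrite (allP pos c ct) !final_score_enc // (allP win c ct).
apply/all_iota_ltP => d ld; case: (boolP (d \in t)) => //= dt.
by apply/blockedbP => //; exact: blk.
Qed.
End DeciderOnEncodings.

Lemma ccpv_te_deciderP k w : 0 < k -> ccpv_te_decider k w <-> CCPV_TE_lang k w.
Proof.
move=> k0; split=> [dec|[I [vI <- yes]]]; last by apply/decider_enc.
have /andP[/well_formedP[I vI eI] _] := dec.
by exists I; split=> //; apply/decider_enc; rewrite ?eI.
Qed.

(** * Computability of the decision procedure *)

Lemma computable_app1 (f : seq bool -> nat -> nat) A :
  computable (fun w rho => f w (rho 0)) -> computable A ->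
  computable (fun w rho => f w (A w rho)).
Proof. by move=> cf cA; apply: (computable_let (B := fun w a _ => f w a)) cA cf. Qed.

Lemma computable_app2 (f : seq bool -> nat -> nat -> nat) A B :
  computable (fun w rho => f w (rho 0) (rho 1)) -> computable A -> computable B ->
  computable (fun w rho => f w (A w rho) (B w rho)).
Proof.
move=> cf cA cB; apply: (computable_let (B := fun w b rho => f w (A w rho) b)) cB _.
apply: (computable_let (B := fun w a rho => f w a (rho 0)) (computable_weak succn cA)).
exact: cf.
Qed.

Ltac compute_step := cbv beta; first
  [ assumption
  | apply: computable_var | apply: computable_size | apply: computable_const
  | apply: computable_add | apply: computable_mul
  | apply: computable_count | apply: decidable_in_const
  | apply: decidable_in_bit | apply: decidable_in_neg | apply: decidable_in_mem => [|?]
  | apply: decidable_in_lt | apply: decidable_in_leq | apply: decidable_in_eq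
  | apply: decidable_in_and | apply: decidable_in_or | apply: decidable_in_imp
  | apply: decidable_in_has_tuple => [|? _] | apply: decidable_in_has | apply: decidable_in_all ].

Lemma computable_zeros_before A :
  computable A -> computable (fun w rho => zeros_before w (A w rho)).
Proof. by apply: computable_app1; rewrite /zeros_before; repeat compute_step. Qed.

Lemma computable_block A : computable A -> computable (fun w rho => block w (A w rho)).
Proof.
apply: computable_app1; rewrite /block; do 4 try compute_step.
all: try (apply: computable_zeros_before); repeat compute_step.
Qed.

Lemma computable_zero : computable (fun _ _ => 0).
Proof. by exists Zero. Qed.

Ltac compute_blocks := repeat first
  [ apply: computable_zeros_before | apply: computable_block | apply: computable_zero
  | compute_step ].

Lemma computable_candidates : computable (fun w _ => candidates w).
Proof. by rewrite /candidates; compute_blocks. Qed.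

Lemma computable_preferred : computable (fun w _ => preferred w).
Proof. by rewrite /preferred; compute_blocks. Qed.

Lemma computable_voters : computable (fun w _ => voters w).
Proof. by rewrite /voters; compute_blocks. Qed.

Lemma computable_entry A B : computable A -> computable B ->
  computable (fun w rho => entry w (A w rho) (B w rho)).
Proof.
apply: computable_app2; rewrite /entry.
by repeat first [apply: computable_candidates | apply: computable_block | compute_step].
Qed.

Ltac compute_instance := repeat first
  [ apply: computable_candidates | apply: computable_preferred | apply: computable_voters
  | apply: computable_entry | apply: computable_zeros_before | apply: computable_block
  | apply: computable_zero | compute_step ].

Lemma decidable_in_well_formed : decidable_in (fun w _ => well_formed w).
Proof. by rewrite /well_formed; compute_instance. Qed.

Lemma decidable_in_ccpv_te_decider k : decidable_in (fun w _ => ccpv_te_decider k w).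
Proof.
rewrite /ccpv_te_decider /blockedb /top_votes /final_score; apply: decidable_in_and.
  exact: decidable_in_well_formed.
by compute_instance.
Qed.

Theorem theorem5 (k : nat) : 2 <= k -> in_P (CCPV_TE_lang k).
Proof.
(* The empty string is rejected by computation: it has no candidates, so [preferred] is not below
   [candidates]. *)
move=> k2; apply: (in_P_decidable_in (decidable_in_ccpv_te_decider k)) => [|w] //.
by apply: ccpv_te_deciderP; lia.
Qed.
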